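(* Let $0<\delta<1/16$ and let $G=(V,E)$ be a $\delta$-good directed expander on $n$ vertices. Then there is a deterministic identification procedure for $G$ (a map taking each directed report profile $r$ on $G$ to a pair of disjoint sets $T'(r),B'(r)\subseteq V$) such that for every partition $V=T\cup B$, $T\cap B=\emptyset$, with $|T|>|B|$, and every directed report profile $r$ consistent with $(T,B)$, we have $T'(r)\subseteq T$, $B'(r)\subseteq B$ and $|T'(r)\cup B'(r)|>(1-\delta)n$. That is, from the reports of each vertex about all its out-neighbors one can recover the type of almost all vertices of $G$. Moreover, if $|T|>(1/2+2\delta)n$, then there is an algorithm running in time linear in the size of $G$ which, given $G$ and a directed report profile consistent with $(T,B)$, outputs sets $T'\subseteq T$ and $B'\subseteq B$ with $|T'\cup B'|>(1-\delta)n$.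
   Context: Corruption detection model (directed case). $G=(V,E)$ is a finite directed graph, and $V=T\cup B$, $T\cap B=\emptyset$, where vertices of $T$ are truthful and vertices of $B$ corrupt. For each directed edge $(u,v)\in E$, vertex $u$ reports whether $v$ is truthful or corrupt. A directed report profile is a function $r:E\to\{\text{truthful},\text{corrupt}\}$, $r(u,v)$ being $u$'s report about its out-neighbor $v$. It is consistent with $(T,B)$ if for every edge $(u,v)\in E$ with $u\in T$, $r(u,v)$ equals the true type of $v$; reports of corrupt vertices are arbitrary (adversarial, possibly coordinated). For a fixed $0<\delta<1/16$, a directed graph $G=(V,E)$ on $n$ vertices is a $\delta$-good directed expander if: (i) for every set $U\subseteq V$ with $|U|\le 4\delta n$ we have $|N^+(U)\setminus U|>|U|$, where $N^+(U)$ is the set of all out-neighbors of vertices of $U$; and (ii) for any two disjoint sets of vertices $A$ and $C$ with $|A|\ge\delta n$ and $|C|\ge n/4$ there is at least one directed edge from $A$ to $C$ and at least one directed edge from $C$ to $A$. *)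

(* Defs.v *)
From HB Require Import structures.
From mathcomp Require Export all_boot all_order all_algebra.
Set Implicit Arguments.
Unset Strict Implicit.
Unset Printing Implicit Defensive.
Import Order.TTheory GRing.Theory Num.Theory.

(** * Directed graphs, reports, expanders *)

(* A directed graph is a finite vertex type V with an edge set E. *)

Definition edge (V : finType) (E : {set V * V}) := {e : V * V | e \in E}.

Definition src (V : finType) (E : {set V * V}) (e : edge E) : V := (val e).1.
Definition dst (V : finType) (E : {set V * V}) (e : edge E) : V := (val e).2.

Inductive vtype := Truthful | Corrupt.

Definition profile (V : finType) (E : {set V * V}) := {ffun edge E -> vtype}.

Definition is_bipartition (V : finType) (T B : {set V}) : Prop :=
  T :|: B = [set: V] /\ T :&: B = set0.

Definition true_type (V : finType) (T : {set V}) (v : V) : vtype :=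
  if v \in T then Truthful else Corrupt.

Definition consistent (V : finType) (E : {set V * V}) (r : profile E)
    (T : {set V}) : Prop :=
  forall e : edge E, src e \in T -> r e = true_type T (dst e).

Definition out_nbrs (V : finType) (E : {set V * V}) (U : {set V}) : {set V} :=
  [set v | [exists u in U, (u, v) \in E]].

(* In the first clause U is nonempty: for U = set0 the strict inequality
   0 < 0 would make the notion unsatisfiable. *)
Definition good_expander (R : realFieldType) (delta : R)
    (V : finType) (E : {set V * V}) : Prop :=
  let n : R := (#|V|%:R)%R in
  (forall U : {set V}, U != set0 -> (#|U|%:R <= 4 * delta * n)%R ->
     #|U| < #|out_nbrs E U :\: U|) /\
  (forall A C : {set V}, [disjoint A & C] ->
     (delta * n <= #|A|%:R)%R -> (n / 4 <= #|C|%:R)%R ->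
     (exists a c, [/\ a \in A, c \in C & (a, c) \in E]) /\
     (exists a c, [/\ a \in A, c \in C & (c, a) \in E])).

(** * A unit-cost word RAM *)

(* Structured programs over registers and (finitely many, since a program is a
   finite object) arrays of natural numbers.  Subtraction is truncated. *)

Inductive operand := Lit of nat | Reg of nat.

Inductive rvalue :=
  | Mov of operand
  | Add of operand & operand
  | Sub of operand & operand
  | Read of nat & operand.            (* Read a i : cell i of array a *)

Inductive test := Lt of operand & operand | Eq of operand & operand.

Inductive prog :=
  | Skip
  | Assign of nat & rvalue
  | Write of nat & operand & operand  (* Write a i v : a[i] := v *)
  | Seq of prog & prog
  | If of test & prog & prog
  | While of test & prog.

Record state := State { reg : nat -> nat; arr : nat -> nat -> nat }.

Definition upd (A : Type) (f : nat -> A) (i : nat) (x : A) : nat -> A :=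
  fun j => if j == i then x else f j.

Definition oval (s : state) (o : operand) : nat :=
  match o with Lit k => k | Reg x => reg s x end.

Definition rval (s : state) (e : rvalue) : nat :=
  match e with
  | Mov o => oval s o
  | Add o1 o2 => oval s o1 + oval s o2
  | Sub o1 o2 => oval s o1 - oval s o2
  | Read a i => arr s a (oval s i)
  end.

Definition tval (s : state) (b : test) : bool :=
  match b with
  | Lt o1 o2 => oval s o1 < oval s o2
  | Eq o1 o2 => oval s o1 == oval s o2
  end.

Definition set_reg (s : state) (x v : nat) : state :=
  State (upd (reg s) x v) (arr s).

Definition set_cell (s : state) (a i v : nat) : state :=
  State (reg s) (upd (arr s) a (upd (arr s a) i v)).

(* [exec w p s t s'] : started in s, the program p halts in s' after t elementary
   steps (register operations, memory accesses and tests), never writing a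
   number greater than w.  With w linear in the input size, every word used has
   O(log(input size)) bits. *)
Inductive exec (w : nat) : prog -> state -> nat -> state -> Prop :=
  | ExecSkip s : exec w Skip s 1 s
  | ExecAssign s x e : rval s e <= w ->
      exec w (Assign x e) s 1 (set_reg s x (rval s e))
  | ExecWrite s a i o : oval s i <= w -> oval s o <= w ->
      exec w (Write a i o) s 1 (set_cell s a (oval s i) (oval s o))
  | ExecSeq p q s t1 s1 t2 s2 : exec w p s t1 s1 -> exec w q s1 t2 s2 ->
      exec w (Seq p q) s (t1 + t2) s2
  | ExecIfT b p q s t s' : tval s b = true -> exec w p s t s' ->
      exec w (If b p q) s t.+1 s'
  | ExecIfF b p q s t s' : tval s b = false -> exec w q s t s' ->
      exec w (If b p q) s t.+1 s'
  | ExecWhileT b p s t1 s1 t2 s2 : tval s b = true ->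
      exec w p s t1 s1 -> exec w (While b p) s1 t2 s2 ->
      exec w (While b p) s (t1 + t2).+1 s2
  | ExecWhileF b p s : tval s b = false -> exec w (While b p) s 1 s.

Lemma exec_det w p s t1 s1 t2 s2 :
  exec w p s t1 s1 -> exec w p s t2 s2 -> t1 = t2 /\ s1 = s2.
Proof.
move=> E1; elim: E1 t2 s2 => {p s t1 s1} *;
  match goal with E2 : exec _ _ _ _ _ |- _ => inversion E2; subst; clear E2 end;
  try congruence;
  repeat match goal with
  | IH : forall t s, exec ?w ?p ?s0 t s -> _, E2 : exec ?w ?p ?s0 _ _ |- _ =>
    case: (IH _ _ E2) => ? ?; subst; clear IH
  end; by [].
Qed.

(** * Input and output of graph algorithms *)

(* Vertices are numbered 0, .., #|V|.-1 by enum_rank.  A list of adjacency lists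
   is a duplicate-free list of all edges, grouped by source; the order within
   the out-list of a vertex is arbitrary. *)
Definition adjacency_lists (V : finType) (E : {set V * V})
    (es : seq (edge E)) : Prop :=
  [/\ uniq es, forall e, e \in es &
      sorted (fun e f : edge E => enum_rank (src e) <= enum_rank (src f)) es].

Definition code (x : vtype) : nat :=
  match x with Truthful => 1 | Corrupt => 0 end.

(* Register 0 holds the number of vertices and register 1 the number of edges.
   Array 0 holds the #|V|.+1 offsets of the out-lists: the edges leaving vertex
   number i occupy the positions k with arr 0 i <= k < arr 0 i.+1 of arrays 1
   (target of the edge) and 2 (report on the edge).  Everything else is 0. *)
Definition input (V : finType) (E : {set V * V}) (es : seq (edge E))
    (r : profile E) : state :=
  let offsets :=
    [seq count (fun e : edge E => enum_rank (src e) < i) es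
       | i <- iota 0 #|V|.+1] in
  let targets := [seq nat_of_ord (enum_rank (dst e)) | e <- es] in
  let reports := [seq code (r e) | e <- es] in
  State (nth 0 [:: #|V|; #|E|])
        (fun a => nth 0 (nth [::] [:: offsets; targets; reports] a)).

(* The answer is read in array 3: 1 for T', 2 for B', anything else for
   vertices left unclassified. *)
Definition outputT (V : finType) (s : state) : {set V} :=
  [set v | arr s 3 (enum_rank v) == 1].
Definition outputB (V : finType) (s : state) : {set V} :=
  [set v | arr s 3 (enum_rank v) == 2].

Definition graph_size (V : finType) (E : {set V * V}) : nat := #|V| + #|E|.

(* Main.v *)
(** Call (u, v) a trust edge if u reports v truthful.  The truthful set T is closed
under trust edges, and every edge of G inside T is a trust edge.  By property (ii)
a closed subset of T has fewer than delta n vertices or misses fewer than delta n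
vertices of T, so the trust graph has a strongly connected component inside T of
more than |T| - 2 delta n vertices.  Once this component is known, what it reaches
is truthful, the other out-neighbours are corrupt, and by (ii) fewer than delta n
vertices are left.

Two truthful majorities T1, T2 that explain the same reports share their giant
component: otherwise T1 :&: T2 has fewer than 4 delta n vertices and by (i) expands
into the complement of T1 :|: T2, which is smaller than T1 :&: T2.  So the types
common to all explanations suffice for the first part.

If |T| > (1/2 + 2 delta) n the giant component S has more than n/2 vertices.  In a
depth-first search the first discovered vertex of S has all of S among its
descendants; hence some vertex has more than n/2 descendants, and the first such
vertex to be finished lies in S.  A second search from it gives the answer. *)

Require Import Defs.
From mathcomp Require Import all_boot all_order all_algebra.
From mathcomp Require Import zify lra.
Set Implicit Arguments.
Unset Strict Implicit.
Unset Printing Implicit Defensive.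
Import Order.TTheory GRing.Theory Num.Theory.

(** * Strongly connected components of expanders *)

Definition reach (V : finType) (h : rel V) (x : V) : {set V} :=
  [set y | connect h x y].

Definition scc (V : finType) (h : rel V) (x : V) : {set V} :=
  [set y | connect h x y && connect h y x].

Definition out_closed (V : finType) (h : rel V) (X : {set V}) : Prop :=
  forall u v, u \in X -> h u v -> v \in X.

Section Reachability.
Variables (V : finType) (h : rel V).
Implicit Types (X Y : {set V}) (x y : V).

Lemma out_closed_connect X x y :
  out_closed h X -> x \in X -> connect h x y -> y \in X.
Proof.
move=> clX + /connectP[p hp ->]; elim: p x hp => //= z p IH x /andP[hxz hp] Xx.
exact: IH hp (clX _ _ Xx hxz).
Qed.

Lemma reach_closed x : out_closed h (reach h x).
Proof.
move=> u v; rewrite !inE => xu uv.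
exact: connect_trans xu (connect1 uv).
Qed.

Lemma reach_sub X x : out_closed h X -> x \in X -> reach h x \subset X.
Proof.
by move=> clX Xx; apply/subsetP=> y; rewrite inE; apply: out_closed_connect.
Qed.

Lemma reach_refl x : x \in reach h x.
Proof. by rewrite inE connect0. Qed.

Lemma scc_refl x : x \in scc h x.
Proof. by rewrite inE connect0. Qed.

Lemma scc_sub_reach x : scc h x \subset reach h x.
Proof. by apply/subsetP=> y; rewrite !inE => /andP[]. Qed.

Lemma scc_connect x y z : y \in scc h x -> z \in scc h x -> connect h y z.
Proof. by rewrite !inE => /andP[_ yx] /andP[xz _]; apply: connect_trans xz. Qed.

Lemma scc_sym x y : (y \in scc h x) = (x \in scc h y).
Proof. by rewrite !inE andbC. Qed.

Lemma scc_eq x y : y \in scc h x -> scc h y = scc h x.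
Proof.
rewrite inE => /andP[xy yx]; apply/setP=> z; rewrite !inE.
apply/andP/andP=> -[a b]; split; by
  [exact: connect_trans xy a | exact: connect_trans b yx
  |exact: connect_trans yx a | exact: connect_trans b xy].
Qed.

Lemma scc_disjoint x y : y \notin scc h x -> [disjoint scc h x & scc h y].
Proof.
move=> Nyx; apply/pred0P=> z /=; apply/negP=> /andP[zx zy].
by case/negP: Nyx; rewrite -(scc_eq zx) scc_sym.
Qed.

Lemma closedU X Y : out_closed h X -> out_closed h Y -> out_closed h (X :|: Y).
Proof.
move=> cX cY u v; rewrite !inE => /orP[Xu|Yu] uv; apply/orP.
  by left; apply: cX uv.
by right; apply: cY uv.
Qed.

End Reachability.

(** * Edge expansion and the giant component *)

Section Expander.
Variables (R : realFieldType) (delta : R) (V : finType) (E : {set V * V}).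
Hypotheses (delta_gt0 : (0 < delta)%R) (delta_lt : (delta < 1 / 16)%R).
Hypothesis goodE : good_expander delta E.
Local Notation n := (#|V|%:R)%R.
Implicit Types (X : {set V}).

(** No edge leads from [X] to a vertex outside [X :|: out_nbrs E X], so clause (ii) leaves fewer
    than [delta * n] such vertices. *)
Lemma large_dominates X : (n / 4 <= #|X|%:R :> R)%R ->
  ((1 - delta) * n < #|X :|: out_nbrs E X|%:R)%R.
Proof.
move=> Xlarge; set D := X :|: _.
have cD : (#|D|%:R + #|~: D|%:R = n :> R)%R by rewrite -natrD cardsC.
case: (ltrP (#|~: D|%:R)%R (delta * n)%R) => [|small]; first by nra.
have disj : [disjoint ~: D & X].
  by rewrite -setI_eq0 /D setCU -setIA setIC -setIA setICr setI0.
have [_ [a [c []]]] := goodE.2 _ _ disj small Xlarge.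
rewrite /D !inE negb_or => /andP[_ /negP Na] Xc ca.
by case: Na; apply/exists_inP; exists c.
Qed.

Section GiantComponent.
Variables (h : rel V) (T : {set V}).
Hypotheses (clT : out_closed h T) (sub_h : {in T &, forall u v, (u, v) \in E -> h u v}).
Hypothesis T_major : (n / 2 < #|T|%:R :> R)%R.

(** An edge from [X] to [T :\: X] would be a trust edge leaving [X]. As [T] has more than n/2
    vertices, one of the two parts has at least n/4, so clause (ii) yields such an edge as soon as
    both have at least [delta * n]. *)
Lemma closed_small_or_cosmall X : X \subset T -> out_closed h X ->
  (#|X|%:R < delta * n)%R \/ (#|T :\: X|%:R < delta * n)%R.
Proof.
move=> sXT clX.
have cT : (#|X|%:R + #|T :\: X|%:R = #|T|%:R :> R)%R.
  by rewrite -natrD -(cardsID X T) (setIidPr sXT).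
have disj : [disjoint X & T :\: X].
  by apply/pred0P=> z; rewrite /= inE; case: (z \in X).
have noE u v : u \in X -> v \in T :\: X -> (u, v) \in E -> False.
  rewrite inE => Xu /andP[/negP NXv Tv] uv; apply: NXv.
  exact: clX Xu (sub_h (subsetP sXT _ Xu) Tv uv).
case: (ltrP (#|X|%:R)%R (delta * n)%R) => [|Xbig]; first by left.
case: (ltrP (#|T :\: X|%:R)%R (delta * n)%R) => [|Ybig]; first by right.
case: (@ltrP R (#|T :\: X|%:R)%R (n / 4)%R) => [Ysmall|Yhuge]; last first.
  by have [[a [c [Xa Yc ac]]] _] := goodE.2 _ _ disj Xbig Yhuge; case: (noE a c).
have Xhuge : (n / 4 <= #|X|%:R :> R)%R by move: T_major; lra.
rewrite disjoint_sym in disj.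
by have [_ [a [c [Ya Xc ca]]]] := goodE.2 _ _ disj Ybig Xhuge; case: (noE c a).
Qed.

(* Z is a largest small closed subset of T, so it absorbs every vertex of small
   reach; among the others, v has a smallest reach, so every vertex of
   reach v :\: Z has the same reach as v. *)
Lemma giant_component :
  exists2 s, s \in T & (#|T|%:R - 2 * delta * n < #|scc h s|%:R)%R.
Proof.
have n_gt0 : (0 < n :> R)%R.
  rewrite ltr0n lt0n; apply/negP=> /eqP n0; have := max_card (mem T).
  by move: T_major; rewrite n0 leqn0 mul0r ltr0n; case: #|T|.
pose small X := [&& X \subset T, [forall u in X, forall v, h u v ==> (v \in X)]
                  & (#|X|%:R < delta * n)%R].
have smallP X : reflect [/\ X \subset T, out_closed h X & (#|X|%:R < delta * n)%R]
                        (small X).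
  apply: (iffP and3P) => -[sX clX cX]; split=> //.
    by move=> u v Xu uv; apply: (implyP (forallP (forall_inP clX u Xu) v)).
  apply/forall_inP=> u Xu; apply/forallP=> v; apply/implyP; exact: clX.
have small0 : small set0.
  apply/smallP; split; first exact: sub0set.
    by move=> u v; rewrite inE.
  by rewrite cards0 mulr_gt0.
case: (arg_maxnP (fun X : {set V} => #|X|) small0) => Z /smallP[sZ clZ cZ] maxZ.
have small_reach v : v \in T -> (#|reach h v|%:R < delta * n)%R -> v \in Z.
  move=> Tv cv; have sv := reach_sub clT Tv.
  have sU : Z :|: reach h v \subset T by rewrite subUset sZ.
  have clU := closedU clZ (@reach_closed _ h v).
  have cU : (#|Z :|: reach h v|%:R <= #|Z|%:R + #|reach h v|%:R :> R)%R.
    by rewrite -natrD ler_nat cardsU leq_subr.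
  have cD : (#|T|%:R - #|Z :|: reach h v|%:R <= #|T :\: (Z :|: reach h v)|%:R :> R)%R.
    by rewrite lerBlDr -natrD ler_nat cardsD (setIidPr sU) subnK // subset_leq_card.
  (* The union has fewer than [2 * delta * n] vertices; if it missed fewer than [delta * n] vertices
     of [T], then [#|T|] would be below 3n/16. *)
  have [Us|Ubig] := closed_small_or_cosmall sU clU; last first.
    by move: delta_lt T_major; nra.
  have smU : small (Z :|: reach h v) by apply/smallP.
  have eZ : Z = Z :|: reach h v.
    by apply/eqP; rewrite eqEcard subsetUl; apply: maxZ.
  by rewrite eZ inE reach_refl orbT.
have [v0 v0P] : exists v, v \in T :\: Z.
  apply/set0Pn; apply/negP; rewrite setD_eq0 => /subset_leq_card.
  rewrite -(ler_nat R) => ?.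
  by move: delta_lt T_major; nra.
case: (arg_minnP (fun v => #|reach h v|) v0P) => v /setDP[Tv NZv] minv.
have sv := reach_sub clT Tv.
have [vs|vb] := closed_small_or_cosmall sv (@reach_closed _ h v).
  by rewrite small_reach in NZv.
exists v => //.
have sub : reach h v :\: Z \subset scc h v.
  apply/subsetP=> w; rewrite !inE => /andP[NZw vw]; rewrite vw /=.
  have Tw := out_closed_connect clT Tv vw.
  have swv : reach h w \subset reach h v.
    by apply: reach_sub; [exact: reach_closed | rewrite inE].
  have /eqP ewv : reach h w == reach h v.
    by rewrite eqEcard swv; apply: minv; apply/setDP.
  by have := reach_refl h v; rewrite -ewv inE.
have c1 : (#|reach h v|%:R - #|Z|%:R <= #|scc h v|%:R :> R)%R.
  rewrite lerBlDr -natrD ler_nat.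
  apply: leq_trans (leq_add (subset_leq_card sub) (leqnn _)).
  by rewrite addnC -leq_subLR cardsD leq_sub2l // subset_leq_card // subsetIr.
have c2 : (#|T|%:R - #|reach h v|%:R = #|T :\: reach h v|%:R :> R)%R.
  by rewrite cardsD (setIidPr sv) natrB // subset_leq_card.
(* [Z] and [T :\: reach h v] each cost fewer than [delta * n] vertices. *)
lra.
Qed.

End GiantComponent.
End Expander.

(** * Trust edges and consistent types *)

Definition trust (V : finType) (E : {set V * V}) (r : profile E) : rel V :=
  fun u v => [exists e : edge E,
    [&& src e == u, dst e == v & code (r e) == 1]].

(** Reports are compared through [code], as in [trust], because equality on [vtype] is not given as
    a boolean. The boolean form is what allows [feasible] to be a finite set. *)
Definition consistentb (V : finType) (E : {set V * V}) (r : profile E)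
    (T : {set V}) : bool :=
  [forall e : edge E, (src e \in T) ==> (code (r e) == (dst e \in T))].

Section Reports.
Variables (V : finType) (E : {set V * V}) (r : profile E).
Implicit Types (T : {set V}) (e : edge E).

Lemma consistentP T : reflect (consistent r T) (consistentb r T).
Proof.
apply: (iffP forallP) => H e.
  move=> Te; have /implyP/(_ Te)/eqP := H e.
  by rewrite /true_type; case: (r e); case: (dst e \in T).
apply/implyP=> Te; rewrite H // /true_type.
by case: (dst e \in T).
Qed.

Lemma consistent_code T e :
  consistent r T -> src e \in T -> code (r e) = (dst e \in T).
Proof. by move=> /consistentP/forallP/(_ e)/implyP cT /cT /eqP. Qed.

Lemma edgeP u v : (u, v) \in E -> exists e : edge E, src e = u /\ dst e = v.
Proof. by move=> uv; exists (exist _ (u, v) uv). Qed.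

Lemma trustP u v : reflect (exists e : edge E, [/\ src e = u, dst e = v & code (r e) = 1])
  (trust r u v).
Proof.
apply: (iffP existsP) => -[e]; first by case/and3P=> /eqP <- /eqP <- /eqP ?; exists e.
by case=> <- <- re; exists e; rewrite !eqxx re.
Qed.

Lemma consistent_closed T : consistent r T -> out_closed (trust r) T.
Proof.
move=> cT u v Tu /trustP[e [eu <- /eqP]].
by rewrite (consistent_code cT) ?eu //; case: (_ \in _).
Qed.

Lemma consistent_trust T : consistent r T ->
  {in T &, forall u v, (u, v) \in E -> trust r u v}.
Proof.
move=> cT u v Tu Tv /edgeP[e [eu ev]]; apply/trustP; exists e; split=> //.
by rewrite (consistent_code cT) ?eu // ev Tv.
Qed.

Lemma mem_out_nbrs (U : {set V}) v :
  reflect (exists e : edge E, src e \in U /\ dst e = v) (v \in out_nbrs E U).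
Proof.
rewrite inE; apply: (iffP exists_inP) => [[u Uu /edgeP[e [eu ev]]]|[e [Ue <-]]].
  by exists e; rewrite eu.
by exists (src e) => //; have := valP e; rewrite /src /dst; case: (val e).
Qed.

End Reports.

(** * Truthful majorities that explain the same reports *)

Lemma majorities_overlap (V : finType) (T1 T2 : {set V}) :
  #|~: T1| < #|T1| -> #|~: T2| < #|T2| -> #|~: (T1 :|: T2)| < #|T1 :&: T2|.
Proof.
(* [#|T1| + #|T2|] exceeds [#|V|] and equals [#|T1 :|: T2| + #|T1 :&: T2|]. *)
have := cardsUI T1 T2; have := cardsC T1; have := cardsC T2.
have := cardsC (T1 :|: T2).
move: #|~: (T1 :|: T2)| #|T1 :|: T2| #|T1 :&: T2| #|~: T1| #|~: T2| #|T1| #|T2| #|V|.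
lia.
Qed.

Section TwoTruthfulSets.
Variables (R : realFieldType) (delta : R) (V : finType) (E : {set V * V}).
Hypotheses (delta_gt0 : (0 < delta)%R) (delta_lt : (delta < 1 / 16)%R).
Hypothesis goodE : good_expander delta E.
Variable r : profile E.
Local Notation n := (#|V|%:R)%R.
Local Notation h := (trust r).

Lemma majority_half (T : {set V}) : #|~: T| < #|T| -> (n / 2 < #|T|%:R :> R)%R.
Proof.
rewrite -(ltr_nat R) => lt; rewrite -(cardsC T) natrD; move: lt.
lra.
Qed.

(** The bound does not depend on [T], so giant components of different majorities can be
    compared. *)
Lemma majority_giant (T : {set V}) : #|~: T| < #|T| -> consistent r T ->
  exists2 s, s \in T & (n / 2 - 2 * delta * n < #|scc h s|%:R)%R.
Proof.
move=> majT cT; have mT := majority_half majT.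
have [s Ts sP] := giant_component delta_gt0 delta_lt goodE
  (consistent_closed cT) (consistent_trust cT) mT.
by exists s => //; lra.
Qed.

(* If the two giant components differ, they leave out fewer than 4 delta n
   vertices, so W = T1 :&: T2 expands into ~: (T1 :|: T2); but majority makes
   T1 :&: T2 the larger of the two. *)
Lemma majority_giant_unique (T1 T2 : {set V}) s1 s2 :
  #|~: T1| < #|T1| -> #|~: T2| < #|T2| -> consistent r T1 -> consistent r T2 ->
  s1 \in T1 -> s2 \in T2 ->
  (n / 2 - 2 * delta * n < #|scc h s1|%:R)%R ->
  (n / 2 - 2 * delta * n < #|scc h s2|%:R)%R ->
  s2 \in scc h s1.
Proof.
move=> maj1 maj2 c1 c2 T1s T2s big1 big2; apply/negPn/negP=> Ns.
have cl1 := consistent_closed c1; have cl2 := consistent_closed c2.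
have disj := scc_disjoint Ns.
have sub1 : scc h s1 \subset T1.
  exact: subset_trans (scc_sub_reach _ _) (reach_sub cl1 T1s).
have sub2 : scc h s2 \subset T2.
  exact: subset_trans (scc_sub_reach _ _) (reach_sub cl2 T2s).
have n_gt0 : (0 < n :> R)%R.
  by rewrite ltr0n; apply/card_gt0P; exists s1.
have [b1 b2] : (n / 4 <= #|scc h s1|%:R :> R)%R /\ (n / 4 <= #|scc h s2|%:R :> R)%R.
  by move: delta_lt; split; nra.
have b1' : (delta * n <= #|scc h s1|%:R :> R)%R by move: delta_lt; nra.
have [[a [c [aP cP ac]]] [a' [c' [aP' cP' ca]]]] := goodE.2 _ _ disj b1' b2.
(* Inside a consistent [T], the edges found in both directions are trust edges and would merge the
   two components. *)
have notboth (T : {set V}) : consistent r T -> scc h s1 \subset T ->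
    scc h s2 \subset T -> False.
  move=> cT sT1 sT2; case/negP: Ns; rewrite inE.
  have e1 := consistent_trust cT (subsetP sT1 _ aP) (subsetP sT2 _ cP) ac.
  have e2 := consistent_trust cT (subsetP sT2 _ cP') (subsetP sT1 _ aP') ca.
  apply/andP; split.
    apply: connect_trans (scc_connect (scc_refl h s1) aP) _.
    exact: connect_trans (connect1 e1) (scc_connect cP (scc_refl h s2)).
  apply: connect_trans (scc_connect (scc_refl h s2) cP') _.
  exact: connect_trans (connect1 e2) (scc_connect aP' (scc_refl h s1)).
(* A closed set that meets a strongly connected component contains all of it. *)
have out (T : {set V}) s :
    out_closed h T -> ~ scc h s \subset T -> [disjoint scc h s & T].
  move=> clT Nsub; apply/pred0P=> z /=; apply/negP=> /andP[zs Tz]; apply: Nsub.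
  apply/subsetP=> w ws; exact: out_closed_connect clT Tz (scc_connect zs ws).
have d12 : [disjoint scc h s1 & T2] by apply: out => // s12; apply: notboth s12 sub2.
have d21 : [disjoint scc h s2 & T1] by apply: out => // s21; apply: notboth sub1 s21.
pose W := T1 :&: T2.
have sW : W \subset ~: (scc h s1 :|: scc h s2).
  apply/subsetP=> z; rewrite !(in_setI, in_setC, in_setU) => /andP[z1 z2].
  by rewrite (disjointFl d12 z2) (disjointFl d21 z1).
have cU :
    (#|~: (scc h s1 :|: scc h s2)|%:R + (#|scc h s1|%:R + #|scc h s2|%:R) = n :> R)%R.
  rewrite -!natrD -(cardsC (scc h s1 :|: scc h s2)) addnC.
  by rewrite (cardsU (scc h s1)) disjoint_setI0 // cards0 subn0.
have cW : (#|W|%:R <= 4 * delta * n)%R.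
  have : (#|W|%:R <= #|~: (scc h s1 :|: scc h s2)|%:R :> R)%R.
    by rewrite ler_nat subset_leq_card.
  lra.
have cardW := majorities_overlap maj1 maj2.
have W0 : W != set0 by rewrite -card_gt0; apply: leq_ltn_trans cardW.
have := goodE.1 _ W0 cW; apply/negP; rewrite -leqNgt.
apply: leq_trans (ltnW cardW); apply: subset_leq_card.
(* The source of the edge is truthful in both explanations, so its report gives the target the same
   type in both: a target outside [W] is outside [T1 :|: T2]. *)
apply/subsetP=> v /setDP[/mem_out_nbrs[e [We <-]]].
have [e1 e2] := setIP We.
have := consistent_code c1 e1; rewrite (consistent_code c2 e2) !inE.
by case: (_ \in T1); case: (_ \in T2).
Qed.

Definition feasible : {set {set V}} :=
  [set T : {set V} | (#|~: T| < #|T|) && consistentb r T].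

(** An intersection over no sets is the whole vertex set; the first case keeps the two answers
    disjoint when nothing explains the reports. *)
Definition forced_types : {set V} * {set V} :=
  if feasible == set0 then (set0, set0)
  else (\bigcap_(T in feasible) T, \bigcap_(T in feasible) ~: T).

Lemma forced_disjoint : [disjoint forced_types.1 & forced_types.2].
Proof.
rewrite /forced_types; case: eqP => [_|/eqP/set0Pn[T fT]] /=.
  by rewrite -setI_eq0 set0I.
apply/pred0P=> v /=; apply/negP=> /andP[/bigcapP/(_ T fT) Tv /bigcapP/(_ T fT)].
by rewrite inE Tv.
Qed.

(** Every feasible set contains the common giant component and whatever it reaches, so a report from
    there fixes the type of its target in all explanations. [large_dominates] counts these
    targets. *)
Lemma forced_typesP (T : {set V}) : #|~: T| < #|T| -> consistent r T ->
  [/\ forced_types.1 \subset T, forced_types.2 \subset ~: T &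
     ((1 - delta) * n < #|forced_types.1 :|: forced_types.2|%:R)%R].
Proof.
move=> majT cT; have fT : T \in feasible by rewrite inE majT; apply/consistentP.
rewrite /forced_types; case: eqP => [f0|_] /=; first by rewrite f0 inE in fT.
split; [exact: bigcap_inf | exact: bigcap_inf |].
have [s Ts sbig] := majority_giant majT cT.
have reach_in T2 : T2 \in feasible -> reach h s \subset T2.
  rewrite inE => /andP[maj2 /consistentP c2].
  have [s2 T2s2 s2big] := majority_giant maj2 c2.
  have ss2 := majority_giant_unique maj2 majT c2 cT T2s2 Ts s2big sbig.
  have cl2 := consistent_closed c2.
  apply: (reach_sub cl2); apply: (out_closed_connect cl2 T2s2).
  by move: ss2; rewrite inE => /andP[].
have rbig : (n / 4 <= #|reach h s|%:R :> R)%R.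
  have : (#|scc h s|%:R <= #|reach h s|%:R :> R)%R.
    by rewrite ler_nat subset_leq_card // scc_sub_reach.
  have : (0 <= n :> R)%R by apply: ler0n.
  move: delta_lt; nra.
apply: lt_le_trans (large_dominates goodE rbig) _; rewrite ler_nat.
apply: subset_leq_card; rewrite subUset; apply/andP; split.
  by apply: subset_trans (subsetUl _ _); apply/bigcapsP.
apply/subsetP=> v /mem_out_nbrs[e [se <-]]; rewrite inE.
case ec: (code (r e) == 1); [apply/orP; left | apply/orP; right].
  apply/bigcapP=> T2 fT2; apply: (subsetP (reach_in _ fT2)).
  by apply: reach_closed se _; apply/trustP; exists e; rewrite (eqP ec).
apply/bigcapP=> T2 fT2; rewrite inE; apply: contraFN ec => T2e.
have /andP[_ /consistentP c2] : (#|~: T2| < #|T2|) && consistentb r T2.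
  by move: fT2; rewrite inE.
by rewrite (consistent_code c2 (subsetP (reach_in _ fT2) _ se)) T2e.
Qed.

End TwoTruthfulSets.

(** * Weakest preconditions and adjacency lists *)

(** The postcondition also receives the step count. A loop gets [False]: [wp] serves loop-free code,
    and loops go through [exec_while]. *)
Fixpoint wp (w : nat) (p : prog) (s : state) (Q : nat -> state -> Prop) : Prop :=
  match p with
  | Skip => Q 1 s
  | Assign x e => rval s e <= w /\ Q 1 (set_reg s x (rval s e))
  | Write a i o =>
      oval s i <= w /\ oval s o <= w /\ Q 1 (set_cell s a (oval s i) (oval s o))
  | Seq p q => wp w p s (fun t1 s1 => wp w q s1 (fun t2 => Q (t1 + t2)))
  | If b p q => if Defs.tval s b then wp w p s (fun t => Q t.+1)
                else wp w q s (fun t => Q t.+1)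
  | While _ _ => False
  end.

Lemma wp_exec w p s Q :
  wp w p s Q -> exists t s', exec w p s t s' /\ Q t s'.
Proof.
elim: p s Q => [|x e|a i o|p IHp q IHq|b p IHp q IHq|b p IHp] s Q //=.
- by move=> H; exists 1, s; split=> //; constructor.
- by case=> H1 H2; exists 1; eexists; split; [constructor | exact: H2].
- by case=> H1 [H2 H3]; exists 1; eexists; split; [constructor | exact: H3].
- case/IHp=> t1 [s1 [E1 /IHq[t2 [s2 [E2 H]]]]].
  by exists (t1 + t2), s2; split=> //; apply: ExecSeq E1 E2.
- case eb: (Defs.tval s b).
    by case/IHp=> t [s' [Et H]]; exists t.+1, s'; split=> //; apply: ExecIfT.
  by case/IHq=> t [s' [Et H]]; exists t.+1, s'; split=> //; apply: ExecIfF.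
Qed.

(** [k] bounds the iterations still to come, each costing at most [K] steps for the body and one for
    the test; the final [+ 1] is the failing test. *)
Lemma exec_while w b p K (Inv : nat -> state -> Prop) :
  (forall k s, Inv k s -> Defs.tval s b ->
     wp w p s (fun t s' => t <= K /\ exists2 k', k' < k & Inv k' s')) ->
  forall k s, Inv k s -> exists t s' k',
    [/\ exec w (While b p) s t s', t <= k * K.+1 + 1, Inv k' s' & Defs.tval s' b = false].
Proof.
move=> step k; elim/ltn_ind: k => k IH s Is.
case eb: (Defs.tval s b); last first.
  by exists 1, s, k; split=> //; [apply: ExecWhileF | rewrite addn1].
have [t [s' [Et [tK [k' ltk I']]]]] := wp_exec (step _ _ Is eb).
have [t2 [s2 [k2 [E2 t2le I2 b2]]]] := IH _ ltk _ I'.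
exists (t + t2).+1, s2, k2; split=> //; first exact: ExecWhileT Et E2.
have : k'.+1 * K.+1 <= k * K.+1 by rewrite leq_mul2r ltk orbT.
rewrite mulSn; move: (k' * _) (k * _) t2le; lia.
Qed.

(** In a sorted sequence the entries below [i] form a prefix. This is what makes the counting
    offsets delimit the out-lists. *)
Lemma count_sorted (s : seq nat) i k : sorted leq s -> k < size s ->
  (k < count (fun x => x < i) s) = (nth 0 s k < i).
Proof.
elim: s k => //= x s IH k sxs.
have sS := path_sorted sxs.
case: (ltnP x i) => [lxi|lix].
  by case: k => [|k] /=; [rewrite lxi add1n | rewrite ltnS add1n ltnS => /IH ->].
have alls : all (leq x) s by apply: order_path_min sxs => a b c; apply: leq_trans.
have -> : count (fun y => y < i) s = 0.
  apply/eqP; rewrite -leqn0 leqNgt -has_count -all_predC.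
  by apply: sub_all alls => y /=; rewrite -leqNgt; apply: leq_trans.
case: k => [|k] ksz; first by rewrite /= ltnNge [RHS]ltnNge lix.
rewrite ltn0; apply/esym/negbTE; rewrite -leqNgt; apply: leq_trans lix _.
by apply: (allP alls); apply: mem_nth.
Qed.

(** * Edge positions and offsets in the input arrays *)

Section AdjacencyLists.
Variables (V : finType) (E : {set V * V}) (es : seq (edge E)) (r : profile E).
Hypothesis adj : adjacency_lists es.

Definition rk (v : V) : nat := enum_rank v.

Definition off : nat -> nat :=
  nth 0 [seq count (fun e : edge E => rk (src e) < i) es | i <- iota 0 #|V|.+1].
Definition tgt : nat -> nat := nth 0 [seq rk (dst e) | e <- es].
Definition rep : nat -> nat := nth 0 [seq code (r e) | e <- es].

Lemma input_arr a : arr (input es r) a =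
  match a with 0 => off | 1 => tgt | 2 => rep | _ => nth 0 [::] end.
Proof. by case: a => [|[|[|a]]] //=; rewrite nth_nil. Qed.

Definition outdeg (v : V) : nat := off (rk v).+1 - off (rk v).

Lemma rk_inj : injective rk.
Proof. by move=> u v /val_inj/enum_rank_inj. Qed.

Lemma rk_lt v : rk v < #|V|.
Proof. exact: ltn_ord. Qed.

Lemma rk_surj i : i < #|V| -> exists v, rk v = i.
Proof. by move=> lti; exists (enum_val (Ordinal lti)); rewrite /rk enum_valK. Qed.

Lemma size_edges : size es = #|E|.
Proof.
case: adj => ues alles _; rewrite -(card_uniqP ues).
transitivity #|{: edge E}|; last by rewrite card_sig; apply: eq_card => e; rewrite !inE.
by apply: eq_card => e; rewrite alles.
Qed.

Lemma offE i : i <= #|V| -> off i = count (fun e : edge E => rk (src e) < i) es.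
Proof.
move=> lei; rewrite /off (nth_map 0) ?size_iota ?ltnS //.
by rewrite nth_iota.
Qed.

Lemma off_le i : off i <= #|E|.
Proof.
case: (leqP i #|V|) => [lei|lti]; first by rewrite offE // -size_edges count_size.
by rewrite /off nth_default // size_map size_iota.
Qed.

Lemma off_mono v : off (rk v) <= off (rk v).+1.
Proof.
rewrite !offE ?rk_lt //; last exact/ltnW/rk_lt.
by apply: sub_count => e /= /ltnW.
Qed.

Lemma off_outdeg v : off (rk v) + outdeg v = off (rk v).+1.
Proof. by rewrite /outdeg subnKC // off_mono. Qed.

Lemma lt_off k i : k < size es -> i <= #|V| ->
  (k < off i) = (nth 0 [seq rk (src e) | e <- es] k < i).
Proof.
move=> ksz lei; rewrite offE // -count_sorted ?size_map //.
  by rewrite count_map.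
case: adj => _ _; elim: es => //= e [|f s] //= IH /andP[ef sfs].
by apply/andP; split=> //; apply: IH.
Qed.

(** [lt_off] at [rk v] and at [(rk v).+1] squeezes the rank of the source to [rk v]. *)
Lemma edge_at v k : off (rk v) <= k < off (rk v).+1 ->
  exists e : edge E, [/\ src e = v, tgt k = rk (dst e) & rep k = code (r e)].
Proof.
case/andP=> lek ltk.
have ksz : k < size es by rewrite size_edges (leq_trans ltk) ?off_le.
have [e0 _] : exists e0 : edge E, e0 \in es.
  by case: es ksz => // e s _; exists e; rewrite inE eqxx.
exists (nth e0 es k); split; last 2 first.
- by rewrite /tgt (nth_map e0).
- by rewrite /rep (nth_map e0).
move: lek ltk; rewrite leqNgt !lt_off ?rk_lt //; last exact/ltnW/rk_lt.
rewrite !(nth_map e0) // -leqNgt ltnS => le1 le2.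
by apply: rk_inj; apply/eqP; rewrite eqn_leq le1 le2.
Qed.

Lemma edge_position e : exists k,
  [/\ off (rk (src e)) <= k < off (rk (src e)).+1,
      tgt k = rk (dst e) & rep k = code (r e)].
Proof.
case: (adj) => ues alles _; have ksz : index e es < size es by rewrite index_mem.
exists (index e es); split.
- rewrite leqNgt !lt_off ?rk_lt //; last exact/ltnW/rk_lt.
  by rewrite !(nth_map e) // nth_index // ltnn ltnSn.
- by rewrite /tgt (nth_map e) // nth_index.
- by rewrite /rep (nth_map e) // nth_index.
Qed.

(** The sum telescopes along the offsets. It bounds the edge scans of a whole search. *)
Lemma sum_outdeg : \sum_v outdeg v <= #|E|.
Proof.
rewrite (reindex (@enum_val V V)) /=; last first.
  by apply: onW_bij; apply: enum_val_bij.
have -> : \sum_(j < #|V|) outdeg (enum_val j) = \sum_(0 <= j < #|V|) (off j.+1 - off j).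
  rewrite big_mkord; apply: eq_bigr => j _.
  by rewrite /outdeg /rk enum_valK.
rewrite telescope_sumn_in // => [|j]; last first.
  case/andP=> _ ltj; have [v <-] := rk_surj ltj; exact: off_mono.
exact: leq_trans (leq_subr _ _) (off_le _).
Qed.

Lemma sum_outdeg_seq (q : seq V) : uniq q -> \sum_(v <- q) outdeg v <= #|E|.
Proof.
move=> uq; apply: leq_trans sum_outdeg; rewrite big_uniq //= big_mkcond.
by apply: leq_sum => v _; case: ifP.
Qed.

End AdjacencyLists.

(** * Depth-first search *)

Section DepthFirstSearch.
Variables (V : finType) (E : {set V * V}) (es : seq (edge E)) (r : profile E).
Hypothesis adj : adjacency_lists es.
Local Notation h := (trust r).
Local Notation off := (off es).
Local Notation tgt := (tgt es).
Local Notation rep := (rep es r).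
Local Notation outdeg := (outdeg es).

Variable s0 : V.
Local Notation S := (scc h s0).
Hypothesis S_major : #|V| < 2 * #|S|.

(* [vis] lists the visited vertices in order of discovery, [stk] is the stack
   (top first), [ptr v] is the number of edges of v already scanned, and the
   vertices of rank below [i] need not be tried as roots any more.  By
   [dfs_giant] the first discovered vertex of S stays on the stack. *)
Record dfs_inv (vis stk : seq V) (ptr : V -> nat) (i : nat) : Prop := DfsInv {
  dfs_uniq : uniq vis;
  dfs_sub : {subset stk <= vis};
  dfs_order : pairwise (fun a b => index b vis < index a vis) stk;
  dfs_connect : forall g y, g \in stk -> y \in vis -> index g vis <= index y vis ->
    connect h g y;
  dfs_ptr : forall v, ptr v <= outdeg v;
  dfs_scanned : forall v w k, off (rk v) <= k < off (rk v) + ptr v ->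
    rep k = 1 -> tgt k = rk w -> w \in vis;
  dfs_done : forall v, v \in vis -> v \notin stk -> ptr v = outdeg v;
  dfs_roots : forall v, rk v < i -> v \in vis;
  dfs_bound : i <= #|V|;
  dfs_giant : (forall s, s \in S -> s \notin vis) \/
    exists g, [/\ g \in S, g \in stk &
      forall s, s \in S -> s \in vis -> index g vis <= index s vis] }.

Lemma index_rcons_old (vis : seq V) v y :
  y \in vis -> index y (rcons vis v) = index y vis.
Proof. by move=> yv; rewrite -cats1 index_cat yv. Qed.

Lemma index_rcons_new (vis : seq V) v : v \notin vis -> index v (rcons vis v) = size vis.
Proof. by move=> vv; rewrite -cats1 index_cat (negbTE vv) /= eqxx addn0. Qed.

Lemma dfs_size_vis vis stk ptr i : dfs_inv vis stk ptr i -> size vis <= #|V|.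
Proof. by move=> I; rewrite -(card_uniqP (dfs_uniq I)) max_card. Qed.

Lemma dfs_uniq_stack vis stk ptr i : dfs_inv vis stk ptr i -> uniq stk.
Proof.
move=> I; have := dfs_order I; elim: stk {I} => //= x stk IH /andP[xs /IH ->].
rewrite andbT; apply/negP=> xin; by have := allP xs _ xin; rewrite ltnn.
Qed.

Lemma dfs_size_stack vis stk ptr i : dfs_inv vis stk ptr i -> size stk <= size vis.
Proof. by move=> I; apply: uniq_leq_size (dfs_uniq_stack I) (dfs_sub I). Qed.

Lemma dfs_sum_ptr vis stk ptr i : dfs_inv vis stk ptr i -> \sum_v ptr v <= #|E|.
Proof.
move=> I; apply: leq_trans (sum_outdeg adj).
by apply: leq_sum => v _; apply: dfs_ptr I v.
Qed.

Lemma dfs_init : dfs_inv [::] [::] (fun _ => 0) 0.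
Proof.
split=> //; last by left.
by move=> v w k; rewrite addn0 => /andP[a b]; have := leq_ltn_trans a b; rewrite ltnn.
Qed.

(** The new vertex gets the largest discovery index, so [dfs_connect] needs only that the stack
    reaches it. If it is the first of [S], it becomes the witness [g] of [dfs_giant]. *)
Lemma dfs_push vis stk ptr i v : dfs_inv vis stk ptr i -> v \notin vis ->
  {in stk, forall g, connect h g v} -> dfs_inv (rcons vis v) (v :: stk) ptr i.
Proof.
move=> I Nv conn; have stk_idx g : g \in stk -> index g (rcons vis v) = index g vis.
  by move=> /(dfs_sub I); apply: index_rcons_old.
have vis_lt g : g \in vis -> index g vis < size vis by rewrite index_mem.
split.
- by rewrite rcons_uniq Nv (dfs_uniq I).
- move=> g; rewrite inE mem_rcons inE => /orP[->//|/(dfs_sub I) ->].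
  by rewrite orbT.
- rewrite pairwise_cons; apply/andP; split.
    apply/allP=> g gs; rewrite stk_idx // index_rcons_new //.
    exact: vis_lt (dfs_sub I gs).
  rewrite (eq_in_pairwise (P := mem stk) (r' := fun a b => index b vis < index a vis)).
  + exact: dfs_order I.
  + by move=> a b sa sb; rewrite !stk_idx.
  + exact/allP.
- move=> g y; rewrite inE mem_rcons inE => /orP[/eqP->|gs] /orP[/eqP->|yv].
  + by rewrite connect0.
  + rewrite index_rcons_new // index_rcons_old // => le.
    by have := vis_lt _ yv; rewrite ltnNge le.
  + by move=> _; apply: conn.
  + by rewrite stk_idx // index_rcons_old //; apply: (dfs_connect I).
- exact: dfs_ptr I.
- by move=> u w k a b c; rewrite mem_rcons inE (dfs_scanned I a b c) orbT.
- move=> u; rewrite mem_rcons inE negb_or => /orP[->//|uv] /andP[_ us].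
  exact: (dfs_done I).
- by move=> u /(dfs_roots I) uv; rewrite mem_rcons inE uv orbT.
- exact: dfs_bound I.
- case: (dfs_giant I) => [noS|[g [Sg gs gmin]]]; last first.
    right; exists g; split=> //; first by rewrite inE gs orbT.
    move=> s Ss; rewrite mem_rcons inE stk_idx // => /orP[/eqP->|sv].
      by rewrite index_rcons_new // ltnW // vis_lt // (dfs_sub I).
    by rewrite index_rcons_old // gmin.
  case: (boolP (v \in S)) => Sv.
    right; exists v; split=> //; first by rewrite inE eqxx.
    move=> s Ss; rewrite mem_rcons inE => /orP[/eqP->//|].
    by rewrite (negbTE (noS _ Ss)).
  left=> s Ss; rewrite mem_rcons inE negb_or noS // andbT.
  by apply: contraNneq Sv => <-.
Qed.

Lemma dfs_scan vis stk ptr i x : dfs_inv vis stk ptr i -> x \in stk ->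
  ptr x < outdeg x ->
  (forall w, rep (off (rk x) + ptr x) = 1 -> tgt (off (rk x) + ptr x) = rk w ->
     w \in vis) ->
  dfs_inv vis stk (fun v => if v == x then (ptr x).+1 else ptr v) i.
Proof.
move=> I xs ltx nextx; split; try by case: I.
- by move=> v; case: eqP => [->//|_]; apply: dfs_ptr I v.
- move=> v w k; case: eqP => [->|_]; last exact: dfs_scanned I v w k.
  rewrite addnS ltnS => /andP[le1]; rewrite leq_eqVlt => /orP[/eqP->|lt2].
    exact: nextx.
  by apply: (dfs_scanned I (v := x)); rewrite le1 lt2.
- move=> v vv vs; case: eqP => [e|_]; last exact: (dfs_done I).
  by rewrite e xs in vs.
Qed.

Lemma size_drop_index (vis : seq V) (A : {set V}) x : uniq vis ->
  (forall y, y \in A -> y \in vis /\ index x vis <= index y vis) ->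
  #|A| <= size vis - index x vis.
Proof.
move=> uv sub; rewrite -size_drop -(card_uniqP (drop_uniq _ uv)).
apply: subset_leq_card; apply/subsetP=> y Ay; have [yv le] := sub y Ay.
have := yv; rewrite -{1}(cat_take_drop (index x vis) vis) mem_cat.
case/orP=> // /[dup] yt; rewrite -index_mem size_take_min.
have -> : index y (take (index x vis) vis) = index y vis.
  by have := index_cat y (take (index x vis) vis) (drop (index x vis) vis);
     rewrite cat_take_drop yt.
by rewrite ltnNge geq_min le.
Qed.

(** Only popping the first discovered vertex of [S] could break [dfs_giant]. But by then all of [S]
    has been discovered, from [x] on, so more than half of the vertices were, against the size
    hypothesis. *)
Lemma dfs_pop vis stk ptr i x : dfs_inv vis (x :: stk) ptr i ->
  ptr x = outdeg x -> 2 * (size vis - index x vis) <= #|V| ->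
  dfs_inv vis stk ptr i.
Proof.
move=> I px small.
have /= /andP[xtop ord] := dfs_order I.
have full v : v \in vis -> v \notin stk -> ptr v = outdeg v.
  move=> vv vs; case: (eqVneq v x) => [->//|vx].
  by apply: (dfs_done I) => //; rewrite inE negb_or vx.
split=> //; try by case: I.
- by move=> g gs; apply: (dfs_sub I); rewrite inE gs orbT.
- by move=> g y gs; apply: (dfs_connect I); rewrite inE gs orbT.
case: (dfs_giant I) => [|[g [Sg]]]; first by left.
rewrite inE => /orP[/eqP gx|gs] gmin; last by right; exists g.
subst g; exfalso.
(* Being visited is required only of vertices that reach back to [x], that is, those of [S], so
   trust edges leaving [S] cannot spoil closure. *)
pose Y := [set v | connect h x v && (connect h v x ==> (v \in vis))].
have clY : out_closed h Y.
  move=> u v; rewrite !inE => /andP[xu /implyP uvis] uv.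
  rewrite (connect_trans xu (connect1 uv)) /=; apply/implyP=> vx.
  have ux := connect_trans (connect1 uv) vx.
  have Su : u \in S by rewrite -(scc_eq Sg) inE xu.
  have {}uvis := uvis ux; have xu_idx := gmin u Su uvis.
  (* Vertices below [x] on the stack were discovered before [x], while [x] is the earliest of [S].
     So the edges of [u] have all been scanned. *)
  have us : u \notin stk.
    by apply/negP=> us; have := allP xtop _ us; rewrite ltnNge xu_idx.
  have /trustP[e [eu ev re]] := uv.
  have [k [kpos tk rek]] := edge_position r adj e.
  apply: (dfs_scanned I (v := u) (k := k)); last by rewrite tk ev.
    by rewrite full // off_outdeg -eu.
  by rewrite rek.
have Yx : x \in Y by rewrite inE connect0 (dfs_sub I) ?inE ?eqxx ?implybT.
have Svis y : y \in S -> y \in vis.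
  rewrite -(scc_eq Sg) inE => /andP[xy yx].
  by have := out_closed_connect clY Yx xy; rewrite inE yx => /andP[].
have := @size_drop_index vis S x (dfs_uniq I)
  (fun y Sy => conj (Svis y Sy) (gmin y Sy (Svis y Sy))).
move: #|S| (size vis - _) S_major small; lia.
Qed.

(** The vertices discovered from [x] on are reachable from [x] and form a majority, so they meet
    [S]. Conversely the first discovered vertex of [S] is still on the stack and reaches the top
    [x]. *)
Lemma dfs_found vis stk ptr i x : dfs_inv vis (x :: stk) ptr i ->
  #|V| < 2 * (size vis - index x vis) -> x \in S.
Proof.
move=> I big; pose D := [set y in drop (index x vis) vis].
have cD : #|D| = size vis - index x vis.
  by rewrite cardsE (card_uniqP (drop_uniq _ (dfs_uniq I))) size_drop.
have xs : x \in x :: stk by rewrite inE eqxx.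
have xv := dfs_sub I xs.
have Dvis y : y \in D -> y \in vis /\ index x vis <= index y vis.
  rewrite inE => yd; have yv := mem_drop yd; split=> //.
  have := dfs_uniq I; rewrite -{1}(cat_take_drop (index x vis) vis) cat_uniq.
  case/and3P=> _ /hasPn/(_ y yd) yt _.
  have := index_cat y (take (index x vis) vis) (drop (index x vis) vis).
  rewrite cat_take_drop (negbTE yt) => ->; rewrite size_take index_mem xv.
  exact: leq_addr.
case: (set_0Vmem (D :&: S)) => [DS0|[y /setIP[Dy Sy]]].
  have := cardsUI D S; have := max_card (mem (D :|: S)).
  rewrite DS0 cards0 cD; move: big S_major; move: #|D :|: S| #|S| (size vis - _).
  lia.
have [yv le] := Dvis y Dy.
have xy := dfs_connect I xs yv le.
case: (dfs_giant I) => [/(_ y Sy)|[g [Sg gs gmin]]]; first by rewrite yv.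
have gx : connect h g x.
  apply: (dfs_connect I) => //; move: gs; rewrite inE => /orP[/eqP->//|gs].
  have /= /andP[xtop _] := dfs_order I.
  exact: ltnW (allP xtop _ gs).
rewrite -(scc_eq Sg) inE gx /=.
exact: connect_trans xy (scc_connect Sy Sg).
Qed.

Lemma dfs_skip vis ptr i v : dfs_inv vis [::] ptr i -> rk v = i -> v \in vis ->
  dfs_inv vis [::] ptr i.+1.
Proof.
move=> I rv vv; split; try by case: I.
  move=> u; rewrite ltnS leq_eqVlt -rv => /orP[/eqP/rk_inj->//|lt].
  by apply: (dfs_roots I); rewrite -rv.
by rewrite -rv; apply: rk_lt.
Qed.

(** With an empty stack, [dfs_giant] leaves [S] wholly unvisited, so [s0] is still to be tried as a
    root: the search cannot run out of roots before it finds its vertex. *)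
Lemma dfs_live vis ptr i : dfs_inv vis [::] ptr i -> i < #|V|.
Proof.
move=> I; rewrite ltnNge; apply/negP=> lei.
case: (dfs_giant I) => [/(_ s0 (scc_refl _ _))/negP|[g [_]]] //; apply.
by apply: (dfs_roots I); apply: leq_trans (rk_lt _) lei.
Qed.

End DepthFirstSearch.

(** * Depth-first search as a program *)

Definition seqp (ps : seq prog) (q : prog) : prog := foldr Seq q ps.

Arguments wp : simpl never.

Section WpSteps.
Variables (w : nat) (s : state) (Q : nat -> state -> Prop).

(** The stored value [v] is a separate argument, so each step of a run can be given it in
    mathematical form. *)
Lemma wp_assign x e v p : rval s e = v -> v <= w ->
  wp w p (set_reg s x v) (fun t => Q t.+1) -> wp w (Seq (Assign x e) p) s Q.
Proof. by move=> <-. Qed.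

Lemma wp_write a i o j v p : oval s i = j -> oval s o = v -> j <= w -> v <= w ->
  wp w p (set_cell s a j v) (fun t => Q t.+1) -> wp w (Seq (Write a i o) p) s Q.
Proof. by move=> <- <-. Qed.

Lemma wp_if b c p q : Defs.tval s b = c ->
  wp w (if c then p else q) s (fun t => Q t.+1) -> wp w (If b p q) s Q.
Proof. by rewrite /wp => <-; case: Defs.tval. Qed.

End WpSteps.

(* Registers: 2 next root, 3 number of visited vertices, 4 stack height,
   5 one plus the vertex found (0 during the search), 6 top of the stack,
   7 its number of scanned edges, 9 vertex to push, 10 edge position.
   Arrays: 4 discovery numbers (from 1; 0 if not visited), 5 numbers of scanned
   edges, 6 stack. *)
Definition dfs_push_prog : prog := seqp
  [:: Assign 3 (Add (Reg 3) (Lit 1));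
      Write 4 (Reg 9) (Reg 3);
      Write 6 (Reg 4) (Reg 9);
      Assign 4 (Add (Reg 4) (Lit 1))]
  Skip.

Definition dfs_root_prog : prog := seqp
  [:: Assign 8 (Read 4 (Reg 2))]
  (If (Eq (Reg 8) (Lit 0))
     (seqp [:: Assign 9 (Mov (Reg 2))] dfs_push_prog)
     (seqp [:: Assign 2 (Add (Reg 2) (Lit 1))] Skip)).

Definition dfs_scan_prog : prog := seqp
  [:: Assign 7 (Add (Reg 7) (Lit 1));
      Write 5 (Reg 6) (Reg 7);
      Assign 8 (Read 2 (Reg 10))]
  (If (Eq (Reg 8) (Lit 1))
     (seqp [:: Assign 9 (Read 1 (Reg 10));
               Assign 8 (Read 4 (Reg 9))]
        (If (Eq (Reg 8) (Lit 0)) dfs_push_prog Skip))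
     Skip).

(** Discovery numbers start at 1, so the difference plus 1 counts the vertices discovered from the
    popped one on; it is doubled to be compared with the number of vertices. *)
Definition dfs_pop_prog : prog := seqp
  [:: Assign 4 (Defs.Sub (Reg 4) (Lit 1));
      Assign 8 (Read 4 (Reg 6));
      Assign 8 (Defs.Sub (Reg 3) (Reg 8));
      Assign 8 (Add (Reg 8) (Lit 1));
      Assign 8 (Add (Reg 8) (Reg 8))]
  (If (Lt (Reg 0) (Reg 8)) (seqp [:: Assign 5 (Add (Reg 6) (Lit 1))] Skip) Skip).

Definition dfs_top_prog : prog := seqp
  [:: Assign 8 (Defs.Sub (Reg 4) (Lit 1));
      Assign 6 (Read 6 (Reg 8));
      Assign 7 (Read 5 (Reg 6));
      Assign 10 (Read 0 (Reg 6));
      Assign 10 (Add (Reg 10) (Reg 7));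
      Assign 8 (Add (Reg 6) (Lit 1));
      Assign 8 (Read 0 (Reg 8))]
  (If (Lt (Reg 10) (Reg 8)) dfs_scan_prog dfs_pop_prog).

Definition dfs_body : prog :=
  If (Eq (Reg 4) (Lit 0)) dfs_root_prog dfs_top_prog.

Definition dfs_prog : prog := While (Eq (Reg 5) (Lit 0)) dfs_body.


Section DfsProg.
Variables (V : finType) (E : {set V * V}) (es : seq (edge E)) (r : profile E).
Hypothesis adj : adjacency_lists es.
Local Notation h := (trust r).
Local Notation off := (off es).
Local Notation tgt := (tgt es).
Local Notation rep := (rep es r).
Local Notation outdeg := (outdeg es).

Variable s0 : V.
Local Notation S := (scc h s0).
Hypothesis S_major : #|V| < 2 * #|S|.

Variables (w N M : nat).
Hypotheses (cardV : #|V| = N) (cardE : #|E| = M).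
Hypothesis w_large : 2 * N + M + 2 <= w.

Definition input_rep (s : state) : Prop :=
  [/\ reg s 0 = N, arr s 0 = off, arr s 1 = tgt & arr s 2 = rep].

(** The head of the list is the top of the stack and sits in the highest cell in use. *)
Fixpoint stack_rep (f : nat -> nat) (stk : seq V) : Prop :=
  if stk is x :: stk' then f (size stk') = rk x /\ stack_rep f stk' else True.

Record dfs_rep (s : state) (vis stk : seq V) (ptr : V -> nat) (i : nat) : Prop := DfsRep {
  rep_root : reg s 2 = i;
  rep_vis : reg s 3 = size vis;
  rep_height : reg s 4 = size stk;
  rep_disc : forall v, arr s 4 (rk v) = if v \in vis then (index v vis).+1 else 0;
  rep_ptr : forall v, arr s 5 (rk v) = ptr v;
  rep_stack : stack_rep (arr s 6) stk }.

Lemma stack_rep_upd f stk j y :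
  size stk <= j -> stack_rep f stk -> stack_rep (upd f j y) stk.
Proof.
elim: stk => //= x stk IH lt [fx fs]; split; last exact: IH (ltnW lt) fs.
by rewrite /upd; case: eqP => [e|//]; rewrite -e ltnn in lt.
Qed.

Lemma upd_rk (f : nat -> nat) (u v : V) y :
  upd f (rk u) y (rk v) = if v == u then y else f (rk v).
Proof. by rewrite /upd (inj_eq (@rk_inj V)). Qed.

(** Visits count twice so that a push, which also raises the stack, still gains 1; a scan, a pop and
    a skipped root gain 1 each. The value never exceeds [3 * N + M]. *)
Definition dfs_measure (vis stk : seq V) (ptr : V -> nat) (i : nat) : nat :=
  i + 2 * size vis + \sum_v ptr v - size stk.

(** The [+ 1] keeps [k] positive during the search, which leaves room for the iteration that finds
    the vertex; after it [k] is unconstrained. Array 3 stays zero for the second search. *)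
Definition dfs_loop_inv (k : nat) (s : state) : Prop :=
  [/\ input_rep s, forall j, arr s 3 j = 0 &
   (reg s 5 = 0 /\ exists vis stk ptr i, [/\ dfs_rep s vis stk ptr i,
      dfs_inv es r s0 vis stk ptr i &
      k + dfs_measure vis stk ptr i = 3 * N + M + 1]) \/
   exists2 x, x \in S & reg s 5 = (rk x).+1].

(** The invariant after the push supplies the bounds that make the written numbers fit. The 5 steps
    are four instructions and the closing [Skip]. *)
Lemma wp_dfs_push s (vis stk : seq V) ptr i (v : V) Q : v \notin vis ->
  dfs_rep s vis stk ptr i -> dfs_inv es r s0 (rcons vis v) (v :: stk) ptr i ->
  reg s 9 = rk v ->
  (forall s', dfs_rep s' (rcons vis v) (v :: stk) ptr i ->
     reg s' 0 = reg s 0 -> reg s' 5 = reg s 5 ->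
     (forall a : nat, a < 4 -> arr s' a = arr s a) -> Q 5 s') ->
  wp w dfs_push_prog s Q.
Proof.
move=> Nv Rs I r9 HQ.
have := dfs_size_vis I; have := dfs_size_stack I.
rewrite size_rcons /= cardV ltnS => l1 l2.
have lv : rk v < N by rewrite -cardV rk_lt.
rewrite /dfs_push_prog /seqp /=.
apply: (@wp_assign _ _ _ _ _ (size vis).+1);
  [by rewrite /= /upd /= (rep_vis Rs) addn1 | lia |].
apply: (@wp_write _ _ _ _ _ _ (rk v) (size vis).+1);
  [by rewrite /= -r9 | by [] | lia | lia |].
apply: (@wp_write _ _ _ _ _ _ (size stk) (rk v));
  [by rewrite /= -(rep_height Rs) | by rewrite /= -r9 | lia | lia |].
apply: (@wp_assign _ _ _ _ _ (size stk).+1);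
  [by rewrite /= -(rep_height Rs) addn1 | lia |].
apply: HQ => //; last by case=> [|[|[|[|a]]]].
split=> //=.
- exact: rep_root Rs.
- by rewrite /upd /= size_rcons.
- move=> u; rewrite [LHS](upd_rk _ v u) mem_rcons inE (rep_disc Rs).
  case: (eqVneq u v) => [->|_] /=; first by rewrite index_rcons_new.
  by case: ifP => // uv; rewrite index_rcons_old.
- exact: rep_ptr Rs.
- split; first by rewrite /upd /= eqxx.
  exact: stack_rep_upd (leqnn _) (rep_stack Rs).
Qed.

Lemma sum_incr (f : V -> nat) x :
  \sum_v (if v == x then (f x).+1 else f v) = (\sum_v f v).+1.
Proof.
rewrite (bigD1 x) // [in RHS](bigD1 x) //= eqxx addSn; congr (_ + _).+1.
by apply: eq_bigr => v /negbTE ->.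
Qed.

Lemma wp_dfs_body k s : dfs_loop_inv k s -> Defs.tval s (Eq (Reg 5) (Lit 0)) ->
  wp w dfs_body s (fun t s' => t <= 30 /\ exists2 k', k' < k & dfs_loop_inv k' s').
Proof.
case=> -[r0 a0 a1 a2] a3 [[r5 [vis [stk [ptr [i [Rs I mu]]]]]] _|[x _ r5]];
  last by rewrite /= r5.
have := dfs_size_vis I; have := dfs_size_stack I; have := dfs_sum_ptr adj I.
have := dfs_bound I; rewrite cardV cardE /dfs_measure in mu * => li lp lst lvis.
case: stk => [|x stk] in Rs I mu lst *.
  have li' : i < N by rewrite -cardV (dfs_live I).
  have [v rv] : exists v : V, rk v = i by apply: rk_surj; rewrite cardV.
  apply: (@wp_if _ _ _ _ true); first by rewrite /= /upd /= (rep_height Rs).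
  rewrite /dfs_root_prog /seqp /=.
  have d_v := rep_disc Rs v.
  have d_le : arr s 4 i <= w.
    rewrite -rv d_v; case: ifP => // vv.
    by apply: (@leq_trans (size vis)); [rewrite index_mem | lia].
  apply: (@wp_assign _ _ _ _ _ (arr s 4 i));
    [by rewrite /= /upd /= (rep_root Rs) | by [] |].
  apply: (@wp_if _ _ _ _ (v \notin vis)).
    by rewrite /= /upd /= -rv d_v; case: (v \in vis).
  case: (boolP (v \in vis)) => vv /=.
    apply: (@wp_assign _ _ _ _ _ i.+1);
      [by rewrite /= /upd /= (rep_root Rs) addn1 | lia |].
    split=> //; exists k.-1; first by rewrite /= in mu *; lia.
    split=> //; left; split=> //; exists vis, [::], ptr, i.+1; split.
    + by case: Rs => ? ? ? ? ? ?; split.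
    + exact: dfs_skip I rv vv.
    + rewrite /dfs_measure /=; rewrite /= in mu; lia.
  apply: (@wp_assign _ _ _ _ _ (rk v)); [by rewrite /= /upd /= (rep_root Rs) | lia |].
  have I' : dfs_inv es r s0 (rcons vis v) [:: v] ptr i by apply: dfs_push.
  apply: (wp_dfs_push vv _ I') => //.
    by case: Rs => ? ? ? ? ? ?; split.
  move=> s' Rs' e0 e5 ea; split=> //; exists k.-1; first by rewrite /= in mu *; lia.
  split.
  + by split; rewrite ?e0 ?ea.
  + by move=> j; rewrite ea // a3.
  left; split; first by rewrite e5.
  exists (rcons vis v), [:: v], ptr, i; split=> //.
  rewrite /dfs_measure size_rcons /=; rewrite /= in mu; lia.
have xs : x \in x :: stk by rewrite inE eqxx.
have xv := dfs_sub I xs.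
have lx : rk x < N by rewrite -cardV rk_lt.
have lpx := dfs_ptr I x.
have off_x := off_outdeg es x.
have loff := off_le adj (rk x).+1; rewrite cardE in loff.
have [st_x st_stk] := rep_stack Rs.
rewrite /= in lst mu.
apply: (@wp_if _ _ _ _ false); first by rewrite /= /upd /= (rep_height Rs).
rewrite /dfs_top_prog /seqp /=.
apply: (@wp_assign _ _ _ _ _ (size stk)).
- by rewrite /= /upd /= (rep_height Rs) /= subn1.
- lia.
apply: (@wp_assign _ _ _ _ _ (rk x)); [exact: st_x | lia |].
apply: (@wp_assign _ _ _ _ _ (ptr x)); [exact: rep_ptr Rs x | lia |].
apply: (@wp_assign _ _ _ _ _ (off (rk x))); [by rewrite /= /upd /= a0 | lia |].
apply: (@wp_assign _ _ _ _ _ (off (rk x) + ptr x)); [by [] | lia |].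
apply: (@wp_assign _ _ _ _ _ (rk x).+1); [by rewrite /= /upd /= addn1 | lia |].
apply: (@wp_assign _ _ _ _ _ (off (rk x).+1)); [by rewrite /= /upd /= a0 | lia |].
apply: (@wp_if _ _ _ _ (ptr x < outdeg x)).
  by rewrite /= /upd /= -off_x ltn_add2l.
case: ltnP => px /=.
  rewrite /dfs_scan_prog /seqp /=.
  set k0 := off (rk x) + ptr x.
  have [e [ex ey er]] : exists e : edge E,
      [/\ src e = x, tgt k0 = rk (dst e) & rep k0 = code (r e)].
    by apply: edge_at => //; rewrite /k0; lia.
  set y := dst e in ey.
  have ly : rk y < N by rewrite -cardV rk_lt.
  have lr : rep k0 <= 1 by rewrite er; case: (r e).
  set ptr' := fun v : V => if v == x then (ptr x).+1 else ptr v.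
  have sum' : \sum_v ptr' v = (\sum_v ptr v).+1 by apply: sum_incr.
  apply: (@wp_assign _ _ _ _ _ (ptr x).+1); [by rewrite /= /upd /= addn1 | lia |].
  apply: (@wp_write _ _ _ _ _ _ (rk x) (ptr x).+1); [by [] | by [] | lia | lia |].
  apply: (@wp_assign _ _ _ _ _ (rep k0)); [by rewrite /= /upd /= a2 | lia |].
  set s1 := set_reg _ _ _.
  have Rs1 : dfs_rep s1 vis (x :: stk) ptr' i.
    case: Rs => ? ? ? ? rp ?; split=> //= v.
    by rewrite [LHS](upd_rk _ x v) rp.
  have target z : tgt k0 = rk z -> z = y by rewrite ey => /rk_inj.
  have stay : (rep k0 = 1 -> y \in vis) ->
      exists2 k', k' < k & dfs_loop_inv k' s1.
    move=> yv; exists k.-1; first lia.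
    split=> //; left; split=> //; exists vis, (x :: stk), ptr', i; split=> //.
      by apply: dfs_scan => // z /yv yv' /target ->.
    by rewrite /dfs_measure sum' /=; lia.
  apply: (@wp_if _ _ _ _ (rep k0 == 1)); first by [].
  case: eqP => [rk1|nrk] /=; last by split=> //; apply: stay.
  apply: (@wp_assign _ _ _ _ _ (rk y)); [by rewrite /= /upd /= a1 | lia |].
  apply: (@wp_assign _ _ _ _ _ (if y \in vis then (index y vis).+1 else 0)).
  - by rewrite /= /upd /= (rep_disc Rs).
  - case: ifP => // yv; apply: (@leq_trans (size vis)); [by rewrite index_mem | lia].
  apply: (@wp_if _ _ _ _ (y \notin vis)); first by rewrite /= /upd /=; case: ifP.
  case: (boolP (y \in vis)) => yv /=.
    (* The state differs from [s1] only in the scratch registers 8 and 9, so the loop invariant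
       carries over. *)
    split=> //; have [//|k' ltk Ik'] := stay.
    exists k' => //; case: Ik' => ? ? Ik'; split=> //.
    case: Ik' => [[? [vis' [stk' [ptr'' [i' [[? ? ? ? ? ?] ? ?]]]]]]|?]; last by right.
    by left; split=> //; exists vis', stk', ptr'', i'; split.
  have xy : h x y by apply/trustP; exists e; rewrite ex -er rk1.
  have I1 : dfs_inv es r s0 (rcons vis y) (y :: x :: stk) ptr i.
    apply: dfs_push => // g gs; apply: connect_trans (connect1 xy).
    apply: (dfs_connect I) => //; move: gs; rewrite inE => /orP[/eqP->//|gs].
    have /= /andP[xtop _] := dfs_order I.
    exact: ltnW (allP xtop _ gs).
  (* On the abstract side the push comes before the scan, because [dfs_scan] needs the target to be
     visited already; the program does the two in the other order. *)
  have I2 : dfs_inv es r s0 (rcons vis y) (y :: x :: stk) ptr' i.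
    apply: dfs_scan => //; first by rewrite !inE eqxx orbT.
    by move=> z _ /target ->; rewrite mem_rcons inE eqxx.
  apply: (wp_dfs_push yv _ I2) => //.
    by case: Rs1 => ? ? ? ? ? ?; split.
  have := dfs_size_vis I2; have := dfs_sum_ptr adj I2.
  rewrite size_rcons sum' cardV cardE => lp' lvis'.
  move=> s' Rs' e0 e5 ea; split=> //; exists (k - 2); first lia.
  split.
  + by split; rewrite ?e0 ?ea.
  + by move=> j; rewrite ea //; apply: a3.
  left; split; first by rewrite e5.
  exists (rcons vis y), (y :: x :: stk), ptr', i; split=> //.
  by rewrite /dfs_measure size_rcons sum' /=; lia.
have {}px : ptr x = outdeg x by lia.
rewrite /dfs_pop_prog /seqp /=.
apply: (@wp_assign _ _ _ _ _ (size stk)).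
- by rewrite /= /upd /= (rep_height Rs) /= subn1.
- lia.
have idx : index x vis < size vis by rewrite index_mem.
apply: (@wp_assign _ _ _ _ _ (index x vis).+1).
- by rewrite /= /upd /= (rep_disc Rs) xv.
- lia.
apply: (@wp_assign _ _ _ _ _ (size vis - (index x vis).+1)).
- by rewrite /= /upd /= (rep_vis Rs).
- lia.
apply: (@wp_assign _ _ _ _ _ (size vis - index x vis)).
- rewrite /= /upd /=; lia.
- lia.
apply: (@wp_assign _ _ _ _ _ (2 * (size vis - index x vis))).
- by rewrite /= /upd /= mul2n addnn.
- lia.
apply: (@wp_if _ _ _ _ (N < 2 * (size vis - index x vis))).
  by rewrite /= /upd /= r0.
case: ltnP => big.
  apply: (@wp_assign _ _ _ _ _ (rk x).+1); [by rewrite /= /upd /= addn1 | lia |].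
  (* The search is over, so any value below [k] will do. *)
  split=> //; exists 0; first lia.
  split=> //; right; exists x => //.
  by apply: (dfs_found S_major I); rewrite cardV.
split=> //; exists k.-1; first lia.
split=> //; left; split=> //; exists vis, stk, ptr, i; split.
- by case: Rs => ? ? ? ? ? ?; split.
- by apply: (dfs_pop adj S_major I) => //; rewrite cardV.
- rewrite /dfs_measure; lia.
Qed.

Lemma dfs_progP : exists t s x,
  [/\ exec w dfs_prog (input es r) t s, t <= 31 * (3 * N + M + 1) + 1,
      x \in S & [/\ reg s 5 = (rk x).+1, input_rep s & forall j, arr s 3 j = 0]].
Proof.
have init : dfs_loop_inv (3 * N + M + 1) (input es r).
  split; first by split=> //=; rewrite cardV.
    by move=> j; rewrite input_arr nth_nil.
  left; split=> //; exists [::], [::], (fun _ => 0), 0; split.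
  - by split=> // v; rewrite input_arr nth_nil.
  - exact: dfs_init.
  - by rewrite /dfs_measure big1 //=; lia.
have [t [s [k [Et tle [Is a3 fin] b]]]] := exec_while wp_dfs_body init.
case: fin => [[r5 _]|[x Sx r5]]; first by rewrite /= r5 in b.
by exists t, s, x; split=> //; rewrite mulnC.
Qed.

End DfsProg.

(** * Breadth-first search *)

(* Registers: 6 vertex being scanned, 7 edge position, 9 target of the edge,
   10 and 11 head and tail of the queue, 12 number of scanned edges of the head.
   Arrays: 3 answer, 7 queue. *)
Definition bfs_init_prog : prog := seqp
  [:: Assign 9 (Defs.Sub (Reg 5) (Lit 1));
      Write 3 (Reg 9) (Lit 1);
      Write 7 (Lit 0) (Reg 9);
      Assign 10 (Mov (Lit 0));
      Assign 11 (Mov (Lit 1));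
      Assign 12 (Mov (Lit 0))]
  Skip.

(** The mark 2 is written without a test: under consistent reports a queued vertex is truthful, so
    its report never turns a 1 into a 2. *)
Definition bfs_scan_prog : prog := seqp
  [:: Assign 12 (Add (Reg 12) (Lit 1));
      Assign 9 (Read 1 (Reg 7));
      Assign 8 (Read 2 (Reg 7))]
  (If (Eq (Reg 8) (Lit 1))
     (seqp [:: Assign 8 (Read 3 (Reg 9))]
        (If (Eq (Reg 8) (Lit 0))
           (seqp [:: Write 3 (Reg 9) (Lit 1);
                     Write 7 (Reg 11) (Reg 9);
                     Assign 11 (Add (Reg 11) (Lit 1))]
              Skip)
           Skip))
     (seqp [:: Write 3 (Reg 9) (Lit 2)] Skip)).

Definition bfs_next_prog : prog := seqp
  [:: Assign 10 (Add (Reg 10) (Lit 1));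
      Assign 12 (Mov (Lit 0))]
  Skip.

Definition bfs_body : prog := seqp
  [:: Assign 6 (Read 7 (Reg 10));
      Assign 7 (Read 0 (Reg 6));
      Assign 7 (Add (Reg 7) (Reg 12));
      Assign 8 (Add (Reg 6) (Lit 1));
      Assign 8 (Read 0 (Reg 8))]
  (If (Lt (Reg 7) (Reg 8)) bfs_scan_prog bfs_next_prog).

Definition bfs_prog : prog := While (Lt (Reg 10) (Reg 11)) bfs_body.

Section BfsProg.
Variables (V : finType) (E : {set V * V}) (es : seq (edge E)) (r : profile E).
Hypothesis adj : adjacency_lists es.
Local Notation h := (trust r).
Local Notation off := (off es).
Local Notation tgt := (tgt es).
Local Notation rep := (rep es r).
Local Notation outdeg := (outdeg es).

Variables (w N M : nat).
Hypotheses (cardV : #|V| = N) (cardE : #|E| = M).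
Hypothesis w_large : 2 * N + M + 2 <= w.

Variables (T : {set V}) (x : V).
Hypotheses (consT : consistent r T) (Tx : x \in T).

Local Notation input_rep := (@input_rep V E es r N).

(* The queue is [past ++ todo]; the first [p] edges of the head of [todo] and
   all edges of the vertices in [past] have been scanned. *)
Record bfs_inv (f : nat -> nat) (past todo : seq V) (p : nat) : Prop := BfsInv {
  bfs_uniq : uniq (past ++ todo);
  bfs_sub : {subset past ++ todo <= T};
  bfs_start : x \in past ++ todo;
  bfs_mark : forall v, (f (rk v) == 1) = (v \in past ++ todo);
  bfs_corrupt : forall v, f (rk v) = 2 -> v \notin T;
  bfs_range : forall v : V, f (rk v) <= 2;
  bfs_past : forall (v y : V) k, v \in past -> off (rk v) <= k < off (rk v).+1 ->
    tgt k = rk y -> f (rk y) != 0;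
  bfs_head : forall (v y : V) k, ohead todo = Some v ->
    off (rk v) <= k < off (rk v) + p -> tgt k = rk y -> f (rk y) != 0;
  bfs_ptr : p <= oapp outdeg 0 (ohead todo) }.

Record bfs_rep (s : state) (past todo : seq V) (p : nat) : Prop := BfsRep {
  bfs_rep_head : reg s 10 = size past;
  bfs_rep_tail : reg s 11 = size (past ++ todo);
  bfs_rep_ptr : reg s 12 = p;
  bfs_rep_queue : forall j, j < size (past ++ todo) ->
    arr s 7 j = nth 0 [seq rk v | v <- past ++ todo] j }.

(** Finished queue entries plus scanned edges: each iteration adds exactly 1, up to at most
    [N + M]. *)
Definition bfs_measure (past : seq V) (p : nat) : nat :=
  size past + \sum_(v <- past) outdeg v + p.

Definition bfs_loop_inv (k : nat) (s : state) : Prop :=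
  input_rep s /\ exists past todo p, [/\ bfs_rep s past todo p,
    bfs_inv (arr s 3) past todo p & k + bfs_measure past p = N + M].

Lemma bfs_mark_corrupt f past todo p (y : V) : bfs_inv f past todo p -> y \notin T ->
  bfs_inv (upd f (rk y) 2) past todo p.
Proof.
move=> I NTy; have nz (z : V) : f (rk z) != 0 -> upd f (rk y) 2 (rk z) != 0.
  by rewrite upd_rk; case: (z == y).
split; try by case: I.
- move=> v; rewrite upd_rk; case: (eqVneq v y) => [->|_]; last exact: bfs_mark I v.
  by apply/esym/negbTE; apply: contra NTy; apply: bfs_sub I y.
- by move=> v; rewrite upd_rk; case: (eqVneq v y) => [->//|_]; apply: bfs_corrupt I v.
- by move=> v; rewrite upd_rk; case: (eqVneq v y) => [//|_]; apply: bfs_range I v.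
- by move=> v z k vp kp tk; apply/nz/(bfs_past I vp kp tk).
- by move=> v z k vp kp tk; apply/nz/(bfs_head I vp kp tk).
Qed.

Lemma bfs_enqueue f past u todo p (y : V) : bfs_inv f past (u :: todo) p -> y \in T ->
  f (rk y) = 0 -> bfs_inv (upd f (rk y) 1) past (u :: rcons todo y) p.
Proof.
move=> I Ty fy; have nz (z : V) : f (rk z) != 0 -> upd f (rk y) 1 (rk z) != 0.
  by rewrite upd_rk; case: (z == y).
have Ny : y \notin past ++ u :: todo by rewrite -(bfs_mark I) fy.
have catE : past ++ u :: rcons todo y = rcons (past ++ u :: todo) y.
  by rewrite rcons_cat.
split; rewrite ?catE.
- by rewrite rcons_uniq Ny (bfs_uniq I).
- by move=> v; rewrite mem_rcons inE => /orP[/eqP->//|]; apply: bfs_sub I v.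
- by rewrite mem_rcons inE (bfs_start I) orbT.
- by move=> v; rewrite upd_rk mem_rcons inE -(bfs_mark I); case: (eqVneq v y).
- by move=> v; rewrite upd_rk; case: (eqVneq v y) => [//|_]; apply: bfs_corrupt I v.
- by move=> v; rewrite upd_rk; case: (eqVneq v y) => [//|_]; apply: bfs_range I v.
- by move=> v z k vp kp tk; apply/nz/(bfs_past I vp kp tk).
- by move=> v z k vp kp tk; apply/nz/(bfs_head I vp kp tk).
- exact: bfs_ptr I.
Qed.

Lemma bfs_step f past u todo p : bfs_inv f past (u :: todo) p -> p < outdeg u ->
  (forall y : V, tgt (off (rk u) + p) = rk y -> f (rk y) != 0) ->
  bfs_inv f past (u :: todo) p.+1.
Proof.
move=> I lp next; split; try by case: I.
move=> v z k [<-]; rewrite addnS ltnS => /andP[le1].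
rewrite leq_eqVlt => /orP[/eqP->|lt2]; first exact: next.
by apply: (bfs_head I (v := u)); rewrite ?le1.
Qed.

Lemma bfs_next f past u todo p : bfs_inv f past (u :: todo) p -> p = outdeg u ->
  bfs_inv f (rcons past u) todo 0.
Proof.
move=> I pu; split=> //; rewrite ?cat_rcons; try by case: I.
- move=> v z k; rewrite mem_rcons inE => /orP[/eqP->|vp]; last exact: bfs_past I v z k vp.
  by rewrite -off_outdeg -pu; apply: (bfs_head I).
- by move=> v z k _; rewrite addn0 => /andP[a b]; have := leq_ltn_trans a b; rewrite ltnn.
Qed.

Lemma wp_bfs_body k s : bfs_loop_inv k s -> Defs.tval s (Lt (Reg 10) (Reg 11)) ->
  wp w bfs_body s (fun t s' => t <= 30 /\ exists2 k', k' < k & bfs_loop_inv k' s').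
Proof.
case=> -[r0 a0 a1 a2] [past [todo [p [Rs I mu]]]].
rewrite /= (bfs_rep_head Rs) (bfs_rep_tail Rs) size_cat.
case: todo => [|u todo] in Rs I *; first by rewrite addn0 ltnn.
move=> _; have lsz : size (past ++ u :: todo) <= N.
  by rewrite -cardV -(card_uniqP (bfs_uniq I)) max_card.
(* The head [u] is included, so the measure is below [N + M] and [k] is positive while the queue is
   nonempty. *)
have lsum : \sum_(v <- rcons past u) outdeg v <= M.
  rewrite -cardE; apply: sum_outdeg_seq => //; have := bfs_uniq I.
  by rewrite -cat_rcons cat_uniq => /andP[].
rewrite big_rcons /= in lsum.
have lp := bfs_ptr I; rewrite /= in lp.
have lu : rk u < N by rewrite -cardV rk_lt.
have off_u := off_outdeg es u.
have loff := off_le adj (rk u).+1; rewrite cardE in loff.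
have Tu : u \in T by apply: (bfs_sub I); rewrite mem_cat inE eqxx orbT.
have q_u : arr s 7 (size past) = rk u.
  rewrite (bfs_rep_queue Rs); last by rewrite size_cat addnS ltnS leq_addr.
  by rewrite map_cat nth_cat size_map ltnn subnn.
rewrite /bfs_measure in mu; rewrite size_cat /= in lsz.
rewrite /bfs_body /seqp /=.
apply: (@wp_assign _ _ _ _ _ (rk u));
  [by rewrite /= (bfs_rep_head Rs) q_u | lia |].
apply: (@wp_assign _ _ _ _ _ (off (rk u))); [by rewrite /= /upd /= a0 | lia |].
apply: (@wp_assign _ _ _ _ _ (off (rk u) + p));
  [by rewrite /= /upd /= (bfs_rep_ptr Rs) | lia |].
apply: (@wp_assign _ _ _ _ _ (rk u).+1); [by rewrite /= /upd /= addn1 | lia |].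
apply: (@wp_assign _ _ _ _ _ (off (rk u).+1)); [by rewrite /= /upd /= a0 | lia |].
apply: (@wp_if _ _ _ _ (p < outdeg u)).
  by rewrite /= /upd /= -off_u ltn_add2l.
case: ltnP => pu /=; last first.
  have {}pu : p = outdeg u by lia.
  apply: (@wp_assign _ _ _ _ _ (size past).+1);
    [by rewrite /= /upd /= (bfs_rep_head Rs) addn1 | lia |].
  apply: (@wp_assign _ _ _ _ _ 0); [by [] | by [] |].
  split=> //; exists k.-1; first lia.
  split=> //; exists (rcons past u), todo, 0; split.
  - case: Rs => ? ? ? ?; split=> //=; rewrite ?cat_rcons //.
    by rewrite /upd /= size_rcons.
  - exact: bfs_next I pu.
  - by rewrite /bfs_measure size_rcons big_rcons /=; lia.
rewrite /bfs_scan_prog /seqp /=.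
set k0 := off (rk u) + p.
have [e [eu ey er]] : exists e : edge E,
    [/\ src e = u, tgt k0 = rk (dst e) & rep k0 = code (r e)].
  by apply: edge_at => //; rewrite /k0; lia.
set y := dst e in ey.
have ly : rk y < N by rewrite -cardV rk_lt.
have target (z : V) : tgt k0 = rk z -> z = y by rewrite ey => /rk_inj.
(* [u] is queued, hence truthful, so the report read is the true type of [y]. *)
have repE : rep k0 = (y \in T) by rewrite er (consistent_code consT) ?eu.
apply: (@wp_assign _ _ _ _ _ p.+1);
  [by rewrite /= /upd /= (bfs_rep_ptr Rs) addn1 | lia |].
apply: (@wp_assign _ _ _ _ _ (rk y)); [by rewrite /= /upd /= a1 | lia |].
apply: (@wp_assign _ _ _ _ _ (y \in T));
  [by rewrite /= /upd /= a2 | by case: (y \in T); lia |].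
apply: (@wp_if _ _ _ _ (y \in T)); first by rewrite /= /upd /=; case: (y \in T).
case: (boolP (y \in T)) => Ty /=; last first.
  apply: (@wp_write _ _ _ _ _ _ (rk y) 2); [by [] | by [] | lia | lia |].
  split=> //; exists k.-1; first lia.
  split=> //; exists past, (u :: todo), p.+1; split.
  - by case: Rs => ? ? ? ?; split.
  - apply: bfs_step => //; first exact: bfs_mark_corrupt.
    by move=> z /target ->; rewrite /= /upd /= eqxx.
  - by rewrite /bfs_measure; lia.
have fy : arr s 3 (rk y) <= 1.
  have := bfs_range I y; rewrite leq_eqVlt => /orP[/eqP f2|//].
  by have := bfs_corrupt I f2; rewrite Ty.
apply: (@wp_assign _ _ _ _ _ (arr s 3 (rk y))); [by [] | lia |].
apply: (@wp_if _ _ _ _ (arr s 3 (rk y) == 0)); first by [].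
case: eqP => f0 /=; last first.
  split=> //; exists k.-1; first lia.
  split=> //; exists past, (u :: todo), p.+1; split.
  - by case: Rs => ? ? ? ?; split.
  - by apply: bfs_step => // z /target ->; apply/eqP.
  - by rewrite /bfs_measure; lia.
apply: (@wp_write _ _ _ _ _ _ (rk y) 1); [by [] | by [] | lia | lia |].
apply: (@wp_write _ _ _ _ _ _ (size (past ++ u :: todo)) (rk y)).
- exact: bfs_rep_tail Rs.
- by [].
- by rewrite size_cat /=; lia.
- lia.
apply: (@wp_assign _ _ _ _ _ (size (past ++ u :: todo)).+1).
- by rewrite /= /upd /= (bfs_rep_tail Rs) addn1.
- by rewrite size_cat /=; lia.
split=> //; exists k.-1; first lia.
have catE : past ++ u :: rcons todo y = rcons (past ++ u :: todo) y.
  by rewrite rcons_cat.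
split=> //; exists past, (u :: rcons todo y), p.+1; split.
- case: Rs => ? ? ? queue; split=> //; rewrite catE size_rcons // => j.
  rewrite ltnS map_rcons nth_rcons size_map leq_eqVlt => /orP[/eqP->|ltj].
    by rewrite ltnn eqxx /= /upd /= eqxx.
  by rewrite ltj -queue //= /upd /= (ltn_eqF ltj).
- apply: bfs_step => //; first exact: bfs_enqueue.
  by move=> z /target ->; rewrite /= /upd /= eqxx.
- by rewrite /bfs_measure; lia.
Qed.

(** Once the queue is exhausted, every edge leaving a vertex marked 1 has a marked target. A trusted
    target lies in [T], so its mark is not 2; hence the vertices marked 1 are closed under trust. *)
Lemma bfs_progP s : input_rep s -> reg s 5 = (rk x).+1 -> (forall j, arr s 3 j = 0) ->
  exists t s', [/\ exec w (Seq bfs_init_prog bfs_prog) s t s',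
    t <= 31 * (N + M) + 10, outputT V s' \subset T, outputB V s' \subset ~: T &
    reach h x \subset outputT V s' /\
    out_nbrs E (outputT V s') \subset outputT V s' :|: outputB V s'].
Proof.
case=> r0 a0 a1 a2 r5 a3.
have lx : rk x < N by rewrite -cardV rk_lt.
have [t1 [s1 [E1 [t1le I1]]]] : exists t s', exec w bfs_init_prog s t s' /\
    (t <= 7 /\ bfs_loop_inv (N + M) s').
  apply: wp_exec; rewrite /bfs_init_prog /seqp /=.
  apply: (@wp_assign _ _ _ _ _ (rk x)); [by rewrite /= r5 subn1 | lia |].
  apply: (@wp_write _ _ _ _ _ _ (rk x) 1); [by [] | by [] | lia | lia |].
  apply: (@wp_write _ _ _ _ _ _ 0 (rk x)); [by [] | by [] | lia | lia |].
  apply: (@wp_assign _ _ _ _ _ 0); [by [] | lia |].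
  apply: (@wp_assign _ _ _ _ _ 1); [by [] | lia |].
  apply: (@wp_assign _ _ _ _ _ 0); [by [] | lia |].
  split=> //; split=> //; exists [::], [:: x], 0; split; last first.
  - by rewrite /bfs_measure big_nil /=; lia.
  - set f := arr _ 3.
    have fE (v : V) : f (rk v) = (v == x).
      by rewrite [LHS](upd_rk _ x v) a3; case: (v == x).
    split=> //=.
    + by move=> v; rewrite inE => /eqP ->.
    + by rewrite inE eqxx.
    + by move=> v; rewrite fE inE; case: (v == x).
    + by move=> v; rewrite fE; case: (v == x).
    + by move=> v; rewrite fE; case: (v == x).
    + by move=> v z k _; rewrite addn0 => /andP[a b];
         have := leq_ltn_trans a b; rewrite ltnn.
  - by split=> //= -[].
have [t2 [s2 [k [E2 t2le [_ [past [todo [p [Rs I mu]]]]] stop]]]] :=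
  exec_while wp_bfs_body I1.
exists (t1 + t2), s2; split; first exact: ExecSeq E1 E2.
- have : (N + M) * 31 = 31 * (N + M) by rewrite mulnC.
  by move: t2le; move: ((N + M) * 31) => ? ? ?; lia.
- apply/subsetP=> v; rewrite inE [_ == _](bfs_mark I); exact: bfs_sub I v.
- by apply/subsetP=> v; rewrite !inE => /eqP; apply: bfs_corrupt I v.
have todo0 : todo = [::].
  move: stop; rewrite /= (bfs_rep_head Rs) (bfs_rep_tail Rs) size_cat.
  by case: todo {Rs I mu} => // u todo; rewrite addnS ltnS leq_addr.
rewrite todo0 in I; have markE v : (v \in outputT V s2) = (v \in past).
  by rewrite inE [_ == _](bfs_mark I) cats0.
have marked (e : edge E) : src e \in outputT V s2 -> arr s2 3 (rk (dst e)) != 0.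
  rewrite markE => up; have [k' [kpos tk _]] := edge_position r adj e.
  exact: bfs_past I _ _ _ up kpos tk.
split.
  apply: reach_sub; last by have := bfs_start I; rewrite cats0 markE.
  move=> u v Ou /trustP[e [eu ev re]].
  have := marked e; rewrite eu ev => /(_ Ou) nz.
  have Tu : u \in T by apply: (bfs_sub I); rewrite cats0 -markE.
  have Tv : v \in T.
    by apply: (consistent_closed consT) Tu _; apply/trustP; exists e.
  have := bfs_range I v; have := @bfs_corrupt _ _ _ _ I v; rewrite inE.
  rewrite -/(rk v) Tv; move: nz; case: (arr s2 3 (rk v)) => [|[|[|?]]] // _ /(_ erefl) //.
apply/subsetP=> v /mem_out_nbrs[e [Oe <-]]; have := marked e Oe.
have := bfs_range I (dst e); rewrite !inE -/(rk (dst e)).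
by case: (arr s2 3 (rk (dst e))) => [|[|[|?]]].
Qed.

End BfsProg.

(** * Detection in linear time *)

Definition detect_prog : prog := Seq dfs_prog (Seq bfs_init_prog bfs_prog).

Lemma detect_progP (R : realFieldType) (delta : R) (V : finType) (E : {set V * V})
    (T : {set V}) (r : profile E) (es : seq (edge E)) :
  (0 < delta)%R -> (delta < 1 / 16)%R -> good_expander delta E ->
  ((1 / 2 + 2 * delta) * #|V|%:R < #|T|%:R)%R -> consistent r T ->
  adjacency_lists es ->
  exists t s,
    [/\ exec (200 * graph_size E) detect_prog (input es r) t s,
        t <= 200 * graph_size E, outputT V s \subset T, outputB V s \subset ~: T &
        ((1 - delta) * #|V|%:R < #|outputT V s :|: outputB V s|%:R)%R].
Proof.
move=> d0 d1 goodE bigT consT adj.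
have n_ge0 : (0 <= #|V|%:R :> R)%R by apply: ler0n.
have half : (#|V|%:R / 2 < #|T|%:R :> R)%R by nra.
have [s0 Ts0 s0big] := giant_component d0 d1 goodE
  (consistent_closed consT) (consistent_trust consT) half.
(* The margin [2 * delta] in the size of [T] pays exactly for the loss in [giant_component]. *)
have S_half : (#|V|%:R / 2 < #|scc (trust r) s0|%:R :> R)%R by nra.
have S_major : #|V| < 2 * #|scc (trust r) s0|.
  by rewrite -(ltr_nat R) natrM; lra.
have V_gt0 : 0 < #|V| by apply/card_gt0P; exists s0.
rewrite /graph_size; set N := #|V| in V_gt0 *; set M := #|E|.
have wl : 2 * N + M + 2 <= 200 * (N + M) by lia.
have [t1 [s1 [x [E1 t1le Sx [r5 inp a3]]]]] :=
  dfs_progP adj S_major (erefl N) (erefl M) wl.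
have Tx : x \in T.
  apply: (out_closed_connect (consistent_closed consT) Ts0).
  by move: Sx; rewrite inE => /andP[].
have [t2 [s2 [E2 t2le subT subB [sub_reach sub_nbrs]]]] :=
  bfs_progP adj (erefl N) (erefl M) wl consT Tx inp r5 a3.
exists (t1 + t2), s2; split=> //; first exact: ExecSeq E1 E2.
  (* The two searches take at most [124 * N + 62 * M + 42] steps in total, and [N] is positive. *)
  by move: t1le t2le V_gt0; clear; lia.
have Tbig : (#|V|%:R / 4 <= #|outputT V s2|%:R :> R)%R.
  have : (#|scc (trust r) s0|%:R <= #|outputT V s2|%:R :> R)%R.
    rewrite ler_nat subset_leq_card // -(scc_eq Sx).
    exact: subset_trans (scc_sub_reach _ _) sub_reach.
  by lra.
apply: lt_le_trans (large_dominates goodE Tbig) _; rewrite ler_nat.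
by apply: subset_leq_card; rewrite subUset subsetUl.
Qed.

Theorem theorem1p5 (R : realFieldType) (delta : R)
    (delta_gt0 : (0 < delta)%R) (delta_lt : (delta < 1 / 16)%R) :
  (forall (V : finType) (E : {set V * V}), good_expander delta E ->
     exists proc : profile E -> {set V} * {set V},
       (forall r : profile E, [disjoint (proc r).1 & (proc r).2]) /\
       (forall (T B : {set V}) (r : profile E),
          is_bipartition T B -> #|B| < #|T| -> consistent r T ->
          [/\ (proc r).1 \subset T,
              (proc r).2 \subset B &
              ((1 - delta) * #|V|%:R < #|(proc r).1 :|: (proc r).2|%:R)%R]))
  /\
  (exists (p : prog) (c : nat),
     forall (V : finType) (E : {set V * V}), good_expander delta E ->
     forall (T B : {set V}) (r : profile E) (es : seq (edge E)),
       is_bipartition T B ->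
       ((1 / 2 + 2 * delta) * #|V|%:R < #|T|%:R)%R ->
       consistent r T ->
       adjacency_lists es ->
       exists (t : nat) (s : state),
         [/\ exec (c * graph_size E) p (input es r) t s,
             t <= c * graph_size E,
             outputT V s \subset T,
             outputB V s \subset B &
             ((1 - delta) * #|V|%:R < #|outputT V s :|: outputB V s|%:R)%R]).
Proof.
have complE (V : finType) (T B : {set V}) : is_bipartition T B -> B = ~: T.
  case=> U I; apply/setP=> v; rewrite inE.
  move/setP/(_ v): U; move/setP/(_ v): I; rewrite !inE.
  by case: (v \in T); case: (v \in B).
split=> [V E goodE|].
  exists (@forced_types V E); split=> [r|T B r /complE ->]; first exact: forced_disjoint.
  exact: forced_typesP.
exists detect_prog, 200 => V E goodE T B r es /complE ->.
exact: detect_progP.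
Qed.
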